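(* Let $N\ge 1$ be an integer, let $\mu,\sigma,\tau>0$, let $\mathbb{X}=L^2(\mathbb{R}^N)$ with norm $\|\cdot\|$, let $\mathcal{C}=C([-\tau,0];\mathbb{X})$ with the supremum norm, let $g\in\mathbb{X}$, and let $f$ satisfy $f(0)=0$ and $\|f(\phi_1)-f(\phi_2)\|\le L_f\|\phi_1-\phi_2\|_{\mathcal{C}}$ for all $\phi_1,\phi_2\in\mathcal{C}$. Assume that $\sigma(L_f+1)e^{\mu\tau}-\mu<0$, and let $\mathcal{A}\subset\mathcal{C}$ be the global attractor of the dynamical system $\Phi$ on $\mathcal{C}$ generated by $$\frac{\partial u}{\partial t}(x,t)=\Delta u(x,t)-\mu u(x,t)+\sigma u(x,t-\tau)+f(u(x,t-\tau))+g(x),\quad t>0,\ x\in\mathbb{R}^N,$$ $$u(x,s)=\phi(x,s),\quad -\tau\le s\le 0,\ x\in\mathbb{R}^N.$$ Let $c_2=e^{(\mu-\sigma-1)\tau}$, and let $m\ge1$, $k_m$, $\varrho_1$, $\varrho_m<0$ and $K_m$ be the spectral quantities, described in the context, of the linear delayed Dirichlet problem on the ball $\Omega_K$. Suppose that there exist $t_0>0$ and $0<\alpha<2$ such that $$\eta:=2K_me^{\varrho_mt_0}+\Big(\alpha+\frac{2K_mL_f}{\varrho_1+L_f-\varrho_m}\Big)e^{(L_f+\varrho_1)t_0}+2\sqrt{c_2}\,e^{\frac{[c_2(\sigma+L_f^2)-(\mu-\sigma-1)]t_0}{2}}<1.$$ Then the Hausdorff dimension $d=d_{\mathcal{C}}(\mathcal{A})$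 of $\mathcal{A}$ satisfies $$d<\frac{-\ln k_m-k_m\ln\left(2+\frac4\alpha\right)}{\ln\eta}.$$
   Context: $\|\phi\|_{\mathcal{C}}=\sup_{\theta\in[-\tau,0]}\|\phi(\theta)\|$, and $u_t(\theta)=u(t+\theta)$ for $\theta\in[-\tau,0]$. The nonlinearity is a map $f:\mathbb{X}\to\mathbb{X}$ acting on the delayed state $u(\cdot,t-\tau)$; it is regarded as an operator on $\mathcal{C}$ by writing $f(\phi)$ for $f(\phi(-\tau))$. Solutions are mild: with $S(t)$ the $C_0$-semigroup on $\mathbb{X}$ generated by $\Delta-\mu I$, $$u(t)=S(t)\phi(0)+\sigma\int_0^tS(t-s)u(s-\tau)\,ds+\int_0^tS(t-s)[f(u(s-\tau))+g]\,ds,\quad t>0,\qquad u_0=\phi.$$ Each $\phi\in\mathcal{C}$ has a unique solution $u^\phi\in C([-\tau,\infty);\mathbb{X})$, and $\Phi(t,\phi)=u^\phi_t$. The global attractor is the compact set $\mathcal{A}\subset\mathcal{C}$ with $\Phi(t,\mathcal{A})=\mathcal{A}$ for all $t\ge0$ that attracts every bounded subset of $\mathcal{C}$ in the Hausdorff semidistance. Choice of $K$: fix $\varepsilon>0$ and a bounded set $\mathcal{D}\subset\mathcal{C}$, and let $T(\varepsilon),R(\varepsilon)>0$ be such that $\sup_{\zeta\in[-\tau,0]}\int_{|x|\ge K'}|u^\phi(x,t+\zeta)|^2dx\le\varepsilon$ for all $\phi\in\mathcal{D}$, $t\ge T(\varepsilon)$ and $K'\ge R(\varepsilon)$. Put $K=R(\varepsilon)$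 and $\Omega_K=\{x\in\mathbb{R}^N:|x|<K\}$. Spectral quantities: let $\mathcal{C}_{\Omega_K}=C([-\tau,0];L^2(\Omega_K))$ with the supremum norm, and let $U(t)$, $t\ge0$, be the linear solution semigroup $U(t)\varphi=\tilde v_t^{\varphi}$ on $\mathcal{C}_{\Omega_K}$ of $$\partial_t\tilde v(x,t)=\Delta\tilde v(x,t)-\mu\tilde v(x,t)+\sigma\tilde v(x,t-\tau)\ \text{ in }\Omega_K,\qquad \tilde v=0\ \text{ on }\partial\Omega_K,\qquad \tilde v_0=\varphi.$$ Let $A_U$ be its infinitesimal generator. The spectrum of $A_U$ consists of eigenvalues; denote by $\varrho_1>\varrho_2>\cdots$ the distinct values of their real parts and by $n_j$ the total (algebraic) multiplicity of the eigenvalues with real part $\varrho_j$. In particular $\varrho_1$ is the maximal real part of the eigenvalues of $A_U$. Fix $m\ge1$ with $\varrho_m<0$ and put $k_m=n_1+\cdots+n_m$. Let $P_{k_m}$ be the spectral projection of $\mathcal{C}_{\Omega_K}$ onto the $k_m$-dimensional generalized eigenspace associated with the eigenvalues of real part $\varrho_1,\dots,\varrho_m$, and $Q_{k_m}=I-P_{k_m}$. $K_m>0$ is a constant such that $\|U(t)Q_{k_m}x\|\le K_me^{\varrho_mt}\|x\|$ for all $t\ge0$, $x\in\mathcal{C}_{\Omega_K}$. Hausdorff dimension: for $d\ge0$, $\mu_{\mathcal{C}}(\mathcal{A},d,\varepsilon)=\inf\sum_ir_i^d$, the infimum over all coverings of $\mathcal{A}$ by balls of $\mathcal{C}$ of radii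 $r_i\le\varepsilon$; $\mu_{\mathcal{C}}(\mathcal{A},d)=\lim_{\varepsilon\to0}\mu_{\mathcal{C}}(\mathcal{A},d,\varepsilon)$; $d_{\mathcal{C}}(\mathcal{A})=\inf\{d:\mu_{\mathcal{C}}(\mathcal{A},d)=0\}$. *)

(* Defs.v *)
From HB Require Import structures.
From mathcomp Require Import all_boot all_order all_algebra.
From mathcomp Require Import all_classical all_reals all_analysis.
From mathcomp Require Import measurable_realfun ess_sup_inf.
From mathcomp.real_closed Require Import complex.
Set Implicit Arguments.
Unset Strict Implicit.
Unset Printing Implicit Defensive.
Import Order.TTheory GRing.Theory Num.Theory numFieldNormedType.Exports.
Local Open Scope classical_set_scope.
Local Open Scope ring_scope.

Section Lspace_normedModType.
Context d (T : measurableType d) (R : realType).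
Variables (m : {measure set T -> \bar R}) (p : \bar R) (p1 : (1 <= p)%E).
Local Notation L := (LspaceType m p1).
Local Notation Lf := (LfunType m p1).

Lemma Lspace_finite (x : L) : finite_norm m p (x : T -> R).
Proof. exact: Lebesgue_finite. Qed.

Lemma Lspace_measurable (x : L) : measurable_fun setT (x : T -> R).
Proof. exact: (measurable_funPT (repr (x : {mfun_ m, T >-> measurableTypeR R}))). Qed.

Lemma LspaceP (x : L) : (x : T -> R) \in Lfun m p.
Proof.
rewrite inE /=; apply/andP; split; rewrite inE.
  exact: Lspace_measurable.
exact: Lspace_finite.
Qed.

Definition Lrep (x : L) : Lf := Lfun_Sub p1 (LspaceP x).

Lemma LrepE (x : L) : Lrep x = x :> (T -> R).
Proof. exact: Lfun_valP. Qed.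

Lemma Lnorm_ae (f g : T -> \bar R) : measurable_fun setT f ->
  measurable_fun setT g -> f = g %[ae m] -> ('N[m]_p[f] = 'N[m]_p[g])%E.
Proof.
move=> mf mg fg; rewrite unlock /Lnorm; move: p1; case: p => [r|_|//].
- rewrite lee_fin => r1; congr (_ `^ _)%E; apply: ge0_ae_eq_integral => //.
  + apply: (@measurableT_comp _ _ _ _ _ _ (fun x => x `^ r)%E) => //.
      exact: measurable_poweR.
    exact: measurableT_comp.
  + apply: (@measurableT_comp _ _ _ _ _ _ (fun x => x `^ r)%E) => //.
      exact: measurable_poweR.
    exact: measurableT_comp.
  + by move=> x _; exact: poweR_ge0.
  + by move=> x _; exact: poweR_ge0.
  + by apply: filterS fg => x /= fgx _; rewrite fgx.
- by case: ifP => // _; apply: eq_ess_sup; apply: filterS fg => x /= ->.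
Qed.

Section Lcls.
Variable f : Lf.
Let fm : {mfun T >-> measurableTypeR R} :=
  HB.pack_for {mfun T >-> measurableTypeR R} (f : T -> measurableTypeR R)
    (isMeasurableFun.Build _ _ T (measurableTypeR R) (f : T -> measurableTypeR R)
      (@measurable_funPT _ _ T R f)).
Let q : {mfun_ m, T >-> measurableTypeR R} := \pi_({mfun_ m, T >-> measurableTypeR R})%qT fm.

Let q_ae : (q : T -> R) = f %[ae m].
Proof.
have /eqmodP/asboolP h : (repr q = fm %[mod {mfun_ m, T >-> measurableTypeR R}])%qT.
  by rewrite reprK.
exact: h.
Qed.

Let q_fin : finite_norm m p (q : T -> R).
Proof.
rewrite /finite_norm (@Lnorm_ae _ (EFin \o f)); first exact: Lfunction_finite.
- by apply/measurable_EFinP; exact: (measurable_funPT (repr q)).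
- exact/measurable_EFinP.
- by apply: filterS q_ae => x /= h /h ->.
Qed.

Definition Lcls : L := HB.pack_for L q (isFinLebesgue.Build _ _ _ _ _ p1 q q_fin).

Lemma LclsE : (Lcls : T -> R) = f %[ae m].
Proof. exact: q_ae. Qed.
End Lcls.

Lemma Lspace_inj (x y : L) : x = y %[ae m] -> x = y.
Proof.
move=> xy.
have : x = y :> {mfun_ m, T >-> measurableTypeR R}.
  rewrite -[LHS]reprK -[RHS]reprK; apply/eqmodP/asboolP; exact: xy.
case: x y {xy} => [x [[hx]]] [y [[hy]]] /= E.
by subst y; rewrite (Prop_irrelevance hx hy).
Qed.

Lemma Lcls_ae (f g : Lf) : (f : T -> R) = g %[ae m] -> Lcls f = Lcls g.
Proof.
move=> fg; apply: Lspace_inj.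
exact: ae_eq_trans (LclsE f) (ae_eq_trans fg (ae_eq_sym (LclsE g))).
Qed.

Lemma LrepK : cancel Lrep Lcls.
Proof. by move=> x; apply: Lspace_inj; have := LclsE (Lrep x); rewrite LrepE. Qed.

HB.instance Definition _ := gen_eqMixin L.
HB.instance Definition _ := gen_choiceMixin L.

Definition Lspace_add (x y : L) : L := Lcls (Lrep x + Lrep y).
Definition Lspace_opp (x : L) : L := Lcls (- Lrep x).
Definition Lspace_scale (a : R) (x : L) : L := Lcls (a *: Lrep x).

Lemma LrepC (f : Lf) : (Lrep (Lcls f) : T -> R) = f %[ae m].
Proof. by rewrite LrepE; exact: LclsE. Qed.

Lemma LfunD (f g : Lf) x : (f + g) x = f x + g x.
Proof. by rewrite -[LHS]/(\val (f + g) x) raddfD. Qed.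

Lemma LfunZ a (f : Lf) x : (a *: f) x = a * f x.
Proof. by rewrite -[LHS]/(\val (a *: f) x) linearZ. Qed.

Lemma LfunN (f : Lf) x : (- f) x = - f x.
Proof. by rewrite -[LHS]/(\val (- f) x) raddfN. Qed.

Lemma Lcls_D f g : Lspace_add (Lcls f) (Lcls g) = Lcls (f + g).
Proof.
apply: Lcls_ae; apply: filterS2 (LrepC f) (LrepC g) => x fx gx xT.
by rewrite !LfunD fx// gx.
Qed.

Lemma Lcls_Z a f : Lspace_scale a (Lcls f) = Lcls (a *: f).
Proof.
apply: Lcls_ae; apply: filterS (LrepC f) => x fx xT.
by rewrite !LfunZ fx.
Qed.

Lemma Lcls_N f : Lspace_opp (Lcls f) = Lcls (- f).
Proof.
apply: Lcls_ae; apply: filterS (LrepC f) => x fx xT.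
by rewrite !LfunN fx.
Qed.

Let repL (P : L -> Prop) : (forall f, P (Lcls f)) -> forall x, P x.
Proof. by move=> h x; rewrite -[x]LrepK. Qed.

Let addA : associative Lspace_add.
Proof.
apply: repL => f; apply: repL => g; apply: repL => h.
by rewrite !Lcls_D addrA.
Qed.

Let addC : commutative Lspace_add.
Proof. by apply: repL => f; apply: repL => g; rewrite !Lcls_D addrC. Qed.

Let add0 : left_id (Lcls 0) Lspace_add.
Proof. by apply: repL => f; rewrite Lcls_D add0r. Qed.

Let addN : left_inverse (Lcls 0) Lspace_opp Lspace_add.
Proof. by apply: repL => f; rewrite Lcls_N Lcls_D addNr. Qed.

HB.instance Definition _ := GRing.isZmodule.Build L addA addC add0 addN.

Let scaleA a b (x : L) :
  Lspace_scale a (Lspace_scale b x) = Lspace_scale (a * b) x.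
Proof. by elim/repL: x => f; rewrite !Lcls_Z scalerA. Qed.

Let scale1 : left_id 1 Lspace_scale.
Proof. by apply: repL => f; rewrite Lcls_Z scale1r. Qed.

Let scaleDr : right_distributive Lspace_scale +%R.
Proof.
move=> a; apply: repL => f; apply: repL => g.
rewrite -[X in Lspace_scale a X]/(Lspace_add _ _).
by rewrite Lcls_D !Lcls_Z scalerDr -Lcls_D.
Qed.

Let scaleDl (x : L) : {morph Lspace_scale^~ x : a b / a + b}.
Proof.
move=> a b; elim/repL: x => f.
by rewrite !Lcls_Z scalerDl -Lcls_D.
Qed.

HB.instance Definition _ :=
  GRing.Zmodule_isLmodule.Build R L scaleA scale1 scaleDr scaleDl.

Definition Lspace_norm (x : L) : R := fine ('N[m]_p[EFin \o (x : T -> R)])%E.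

Lemma Lspace_normE f : Lspace_norm (Lcls f) = fine ('N[m]_p[EFin \o f])%E.
Proof.
congr fine; apply: Lnorm_ae.
- by apply/measurable_EFinP; exact: Lspace_measurable.
- exact/measurable_EFinP.
- by apply: filterS (LclsE f) => x /= fx xT; rewrite fx.
Qed.

Let normD (x y : L) : Lspace_norm (x + y) <= Lspace_norm x + Lspace_norm y.
Proof.
elim/repL: x => f; elim/repL: y => g.
rewrite -[Lcls f + _]/(Lspace_add _ _) Lcls_D !Lspace_normE.
exact: ler_LnormD.
Qed.

Let normZ a (x : L) : Lspace_norm (a *: x) = `|a| * Lspace_norm x.
Proof.
elim/repL: x => f.
rewrite -[_ *: _]/(Lspace_scale _ _) Lcls_Z !Lspace_normE.
apply: EFin_inj; rewrite EFinM !finite_norm_fine.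
exact: LnormZ.
Qed.

Let norm0_eq0 (x : L) : Lspace_norm x = 0 -> x = 0.
Proof.
elim/repL: x => f; rewrite Lspace_normE => /fine_Lnormr_eq0 f0.
exact: Lcls_ae.
Qed.

HB.instance Definition _ :=
  Lmodule_isNormed.Build R L normD normZ norm0_eq0.

Lemma Lspace_normrE (x : L) : `|x| = fine ('N[m]_p[EFin \o (x : T -> R)])%E.
Proof. by []. Qed.
End Lspace_normedModType.


Section rV_measurable.
Variables (R : realType) (n : nat).
Let coor (i : 'I_n) (x : 'rV[R]_n) : R := x ord0 i.

Let rV0 : g_sigma_preimage coor set0.
Proof. exact: sigma_algebra0. Qed.

Let rVC A : g_sigma_preimage coor A -> g_sigma_preimage coor (~` A).
Proof. exact: sigma_algebraC. Qed.

Let rVU (F : (set 'rV[R]_n)^nat) : (forall i, g_sigma_preimage coor (F i)) ->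
  g_sigma_preimage coor (\bigcup_i (F i)).
Proof. exact: sigma_algebra_bigcup. Qed.

HB.instance Definition _ := @isMeasurable.Build default_measure_display
  'rV[R]_n (g_sigma_preimage coor) rV0 rVC rVU.

Lemma measurable_coor (i : 'I_n) :
  measurable_fun setT (fun x : 'rV[R]_n => x ord0 i).
Proof.
move=> _ Y mY; rewrite setTI; apply: sub_sigma_algebra => /=.
rewrite -bigcup_seq/=; exists i => /=; first by rewrite mem_index_enum.
by exists Y => //; rewrite setTI.
Qed.

Lemma measurable_fun_rV d (T : measurableType d) (f : T -> 'rV[R]_n) :
  (forall i, measurable_fun setT (fun x => f x ord0 i)) ->
  measurable_fun setT f.
Proof.
move=> mf _ A mA; rewrite setTI.
pose G := [set B : set 'rV[R]_n | measurable (f @^-1` B)].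
have sG : sigma_algebra setT G.
  split.
  - by rewrite /G /= preimage_set0.
  - by move=> B mB; rewrite /G /= setTD -preimage_setC; exact: measurableC.
  - by move=> F mF; rewrite /G /= preimage_bigcup; exact: bigcupT_measurable.
suff h : g_sigma_preimage coor `<=` G.
  exact: (h A mA).
apply: smallest_sub => //.
rewrite -bigcup_seq/= => B [i _ [C mC <-]].
by rewrite /G /= setTI -comp_preimage -[X in measurable X]setTI; exact: mf.
Qed.
End rV_measurable.

Section lebesgue_measure_rV.
Variable R : realType.

Definition rV_cons n (x : R * 'rV[R]_n) : 'rV[R]_n.+1 :=
  \row_i (if unlift ord0 i is Some j then x.2 ord0 j else x.1).

Lemma rV_consE0 n x : @rV_cons n x ord0 ord0 = x.1.
Proof.
by rewrite mxE unlift_none.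
Qed.

Lemma rV_consES n x (i : 'I_n) : @rV_cons n x ord0 (lift ord0 i) = x.2 ord0 i.
Proof.
by rewrite mxE liftK.
Qed.

Lemma measurable_rV_cons n : measurable_fun setT (@rV_cons n).
Proof.
apply: measurable_fun_rV => i.
have [->|[j ->]] : i = ord0 \/ exists j, i = lift ord0 j.
  by case: (unliftP ord0 i) => [j ->|->]; [right; exists j|left].
- under eq_fun do rewrite rV_consE0; exact: measurable_fst.
- under eq_fun do rewrite rV_consES.
  by apply: measurableT_comp (measurable_coor j) _.
Qed.

Definition rV_uncons n (x : 'rV[R]_n.+1) : R * 'rV[R]_n :=
  (x ord0 ord0, \row_i x ord0 (lift ord0 i)).

Lemma rV_consK n : cancel (@rV_cons n) (@rV_uncons n).
Proof.
move=> x; rewrite /rV_uncons rV_consE0 [RHS]surjective_pairing; congr pair.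
by apply/rowP => i; rewrite mxE rV_consES.
Qed.

Lemma measurable_rV_uncons n : measurable_fun setT (@rV_uncons n).
Proof.
apply/measurable_fun_pairP; split; first exact: measurable_coor.
apply: measurable_fun_rV => i.
rewrite (_ : (fun _ => _) = (fun x : 'rV[R]_n.+1 => x ord0 (lift ord0 i))).
  exact: measurable_coor.
by apply/funext => x; rewrite /= mxE.
Qed.

Section step.
Variables (n : nat) (m : {sigma_finite_measure set 'rV[R]_n -> \bar R}).

Definition lebesgue_rV_step : set 'rV[R]_n.+1 -> \bar R :=
  pushforward (lebesgue_measure \x m)%E (@rV_cons n).

Let step0 : lebesgue_rV_step set0 = 0%E.
Proof. by rewrite /lebesgue_rV_step /pushforward preimage_set0 measure0. Qed.

Let step_ge0 A : (0 <= lebesgue_rV_step A)%E.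
Proof. by rewrite /lebesgue_rV_step /pushforward; exact: measure_ge0. Qed.

Let step_sigma_additive : semi_sigma_additive lebesgue_rV_step.
Proof.
exact: (@measure_semi_sigma_additive _ _ _
  (measure_function_pushforward__canonical__measure_function_Measure
     (lebesgue_measure \x m)%E (@measurable_rV_cons n))).
Qed.

HB.instance Definition _ := isMeasure.Build _ _ _ lebesgue_rV_step
  step0 step_ge0 step_sigma_additive.

Let step_sigma_finite : sigma_finite setT lebesgue_rV_step.
Proof.
have /sigma_finiteP[F [TF ndF Foo]] := sigma_finiteT (@lebesgue_measure R).
have /sigma_finiteP[G [TG ndG Goo]] := sigma_finiteT m.
exists (fun k => @rV_uncons n @^-1` (F k `*` G k)).
  apply/seteqP; split=> // x _.
  have [k _ Fk] : (\bigcup_k F k) (rV_uncons x).1 by rewrite -TF.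
  have [l _ Gl] : (\bigcup_k G k) (rV_uncons x).2 by rewrite -TG.
  exists (maxn k l) => //; split.
    by move: Fk; exact/subsetPset/ndF/leq_maxl.
  by move: Gl; exact/subsetPset/ndG/leq_maxr.
move=> k; have [mFk Fk] := Foo k; have [mGk Gk] := Goo k; split.
  by rewrite -[X in measurable X]setTI; apply: measurable_rV_uncons => //;
    exact: measurableX.
rewrite /lebesgue_rV_step /pushforward -comp_preimage.
rewrite (_ : _ \o _ = idfun); last by apply/funext => x; exact: rV_consK.
by rewrite preimage_id product_measure1E// lte_mul_pinfty// ge0_fin_numE.
Qed.

HB.instance Definition _ :=
  Measure_isSigmaFinite.Build _ _ _ lebesgue_rV_step step_sigma_finite.
End step.

Fixpoint lebesgue_rV n : {sigma_finite_measure set 'rV[R]_n -> \bar R} :=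
  if n is k.+1 then lebesgue_rV_step (lebesgue_rV k) else dirac (0 : 'rV[R]_0).
End lebesgue_measure_rV.

(* C([-tau, 0]; V) with the supremum norm. Elements are total functions, set to
   0 outside [-tau, 0] so that equality is equality on [-tau, 0]. *)
Section history_space.
Variables (R : realType) (tau : R) (V : normedModType R).
Local Notation I := `[- tau, 0]%classic.

Definition hist_pred : {pred R -> V} :=
  mem [set f : R -> V | {within I, continuous f} /\
                        forall th, th \notin `[- tau, 0] -> f th = 0].

Lemma hist_submod_closed : submod_closed hist_pred.
Proof.
split; first by rewrite inE; split=> // x; exact: cvg_cst.
move=> a f g; rewrite !inE => -[fc f0] [gc g0]; split.
  by move=> x; exact: (cvgD (cvgZl_tmp (fc x)) (gc x)).
by move=> th thI; rewrite -[LHS]/(a *: f th + g th) f0// g0// scaler0 addr0.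
Qed.

HB.instance Definition _ :=
  GRing.isSubmodClosed.Build _ _ hist_pred hist_submod_closed.

Record hist := Hist { hist_fun :> R -> V; _ : hist_fun \in hist_pred }.

HB.instance Definition _ := [isSub for hist_fun].
HB.instance Definition _ := [Choice of hist by <:].
HB.instance Definition _ := [SubChoice_isSubLmodule of hist by <:].

Lemma hist_continuous (f : hist) : {within I, continuous f}.
Proof. by case: f => f /=; rewrite inE => -[]. Qed.

Lemma hist_out (f : hist) th : th \notin `[- tau, 0] -> f th = 0.
Proof. by case: f => f /=; rewrite inE => -[_]; exact. Qed.

Lemma histD (f g : hist) th : (f + g) th = f th + g th.
Proof. by []. Qed.

Lemma histZ a (f : hist) th : (a *: f) th = a *: f th.
Proof. by []. Qed.

Definition hist_norm (f : hist) : R := sup [set `|f th| | th in I].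

Lemma hist_has_ub (f : hist) : has_ubound [set `|f th| | th in I].
Proof.
have /compact_bounded [M [Mr hM]] : compact (f @` I).
  by apply: continuous_compact; [exact: hist_continuous|exact: segment_compact].
exists (M + 1) => _ [th thI <-].
by apply: (hM (M + 1)); [rewrite ltrDl|exists th].
Qed.

Lemma hist_norm_ge (f : hist) th : I th -> `|f th| <= hist_norm f.
Proof. by move=> thI; apply: ub_le_sup; [exact: hist_has_ub|exists th]. Qed.

Lemma hist_norm_le (f : hist) M : 0 <= M ->
  (forall th, I th -> `|f th| <= M) -> hist_norm f <= M.
Proof.
move=> M0 fM; have [I0|/set0P I0] := eqVneq [set `|f th| | th in I] set0.
  by rewrite /hist_norm I0 sup0.
by apply: ge_sup => // _ [th thI <-]; exact: fM.
Qed.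

Lemma hist_norm_ge0 (f : hist) : 0 <= hist_norm f.
Proof.
have [I0|/set0P[y [th thI _]]] := eqVneq [set `|f th| | th in I] set0.
  by rewrite /hist_norm I0 sup0.
exact: le_trans (normr_ge0 _) (hist_norm_ge f thI).
Qed.

Let normD (f g : hist) : hist_norm (f + g) <= hist_norm f + hist_norm g.
Proof.
apply: hist_norm_le => [|th thI]; first by rewrite addr_ge0// hist_norm_ge0.
rewrite histD; apply: le_trans (ler_normD _ _) _.
by apply: lerD; exact: hist_norm_ge.
Qed.

Let normZ a (f : hist) : hist_norm (a *: f) = `|a| * hist_norm f.
Proof.
have le b (g : hist) : hist_norm (b *: g) <= `|b| * hist_norm g.
  apply: hist_norm_le => [|th thI]; first by rewrite mulr_ge0// hist_norm_ge0.
  by rewrite histZ normrZ ler_wpM2l// hist_norm_ge.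
apply/eqP; rewrite eq_le le /=.
have [->|a0] := eqVneq a 0; first by rewrite normr0 mul0r hist_norm_ge0.
rewrite -ler_pdivlMl ?normr_gt0// -normfV.
by rewrite -[X in hist_norm X <= _](scalerK a0) le.
Qed.

Let norm0_eq0 (f : hist) : hist_norm f = 0 -> f = 0.
Proof.
move=> f0; apply: val_inj; apply/funext => th /=.
have [thI|thI] := boolP (th \in `[- tau, 0]); last exact: hist_out.
by apply/eqP; rewrite -normr_le0 -f0; apply: hist_norm_ge.
Qed.

HB.instance Definition _ :=
  Lmodule_isNormed.Build R hist normD normZ norm0_eq0.

Lemma hist_normE (f : hist) : `|f| = sup [set `|f th| | th in I].
Proof. by []. Qed.
End history_space.

(* Limit of Riemann sums over tagged partitions as the mesh tends to 0. *)
Definition is_Rint (R : realType) (V : normedModType R) (h : R -> V) (a b : R)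
    (J : V) :=
  forall e : R, 0 < e -> exists2 delta : R, 0 < delta &
    forall (n : nat) (t s : nat -> R), t 0%N = a -> t n = b ->
      (forall i, (i < n)%N ->
        t i <= s i <= t i.+1 /\ t i.+1 - t i < delta) ->
      `|\sum_(i < n) (t i.+1 - t i) *: h (s i) - J| < e.

Section semigroups.
Variables (R : realType) (V : normedModType R).

Definition C0_semigroup (S : R -> V -> V) :=
  [/\ forall t, 0 <= t -> linear (S t) /\ continuous (S t),
      forall x, S 0 x = x,
      forall s t x, 0 <= s -> 0 <= t -> S (s + t) x = S s (S t x) &
      forall x, S t x @[t --> 0^'+] --> x].

(* Unbounded operators are represented by their graphs. *)
Definition generator (S : R -> V -> V) (x y : V) : Prop :=
  h^-1 *: (S h x - x) @[h --> 0^'+] --> y.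

Definition generated_by (S : R -> V -> V) (A : V -> V -> Prop) :=
  C0_semigroup S /\ forall x y, generator S x y <-> A x y.

(* Mild solutions of u' = A u + sigma u(t - tau) + F (u(t - tau)), u_0 = phi,
   where S is the semigroup generated by A. *)
Definition mild_solution (S : R -> V -> V) (sigma tau : R) (F : V -> V)
    (phi : hist tau V) (u : R -> V) :=
  [/\ {within `[- tau, +oo[, continuous u},
      forall th, th \in `[- tau, 0] -> u th = phi th &
      forall t, 0 < t -> exists J1 J2 : V,
        [/\ is_Rint (fun s => S (t - s) (u (s - tau))) 0 t J1,
            is_Rint (fun s => S (t - s) (F (u (s - tau)))) 0 t J2 &
            u t = S t (phi 0) + sigma *: J1 + J2]].

Definition solution_semiflow (S : R -> V -> V) (sigma tau : R) (F : V -> V)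
    (Phi : R -> hist tau V -> hist tau V) :=
  forall phi, exists2 u : R -> V, mild_solution S sigma F phi u &
    forall t, 0 <= t -> forall th, th \in `[- tau, 0] ->
      Phi t phi th = u (t + th).
End semigroups.

Section attractors.
Variables (R : realType) (V : normedModType R).

Definition hausdorff_semidist (B A : set V) : \bar R :=
  ereal_sup [set ereal_inf [set `|x - y|%:E | y in A] | x in B].

Definition global_attractor (Phi : R -> V -> V) (A : set V) :=
  [/\ compact A,
      forall t, 0 <= t -> Phi t @` A = A &
      forall B, bounded_set B -> B !=set0 ->
        hausdorff_semidist (Phi t @` B) A @[t --> +oo%R] --> 0%E].

(* The index set I may be finite: with d = 0 each ball counts for 1. *)
Definition hausdorff_premeasure (A : set V) (d e : R) : \bar R :=
  ereal_inf [set s | exists (I : set nat) (c : nat -> V) (r : nat -> R),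
    [/\ forall i, I i -> 0 < r i <= e,
        A `<=` \bigcup_(i in I) ball (c i) (r i) &
        s = (\esum_(i in I) (r i `^ d)%:E)%E]].

Definition hausdorff_measure (A : set V) (d : R) : \bar R :=
  lim (hausdorff_premeasure A d e @[e --> 0^'+]).

Definition hausdorff_dim (A : set V) : \bar R :=
  ereal_inf [set d%:E | d in [set d | 0 <= d /\ hausdorff_measure A d = 0%E]].
End attractors.

Section laplacian.
Variables (R : realType) (N : nat).

Definition partial (i : 'I_N) (psi : 'rV[R]_N -> R) : 'rV[R]_N -> R :=
  fun x => 'D_(delta_mx ord0 i) psi x.

Fixpoint Ck (k : nat) (psi : 'rV[R]_N -> R) : Prop :=
  continuous psi /\
  if k is k'.+1 then
    forall i, (forall x, derivable psi x (delta_mx ord0 i)) /\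
              Ck k' (partial i psi)
  else True.

Definition test_function (O : set 'rV[R]_N) (psi : 'rV[R]_N -> R) :=
  (forall k, Ck k psi) /\
  exists K, [/\ compact K, K `<=` O & forall x, ~ K x -> psi x = 0].

Variables (m : {measure set 'rV[R]_N -> \bar R}) (O : set 'rV[R]_N).

(* u is in H^1_0(O) with weak gradient h: (u, h) is the limit in L^2 of
   (psi_k, grad psi_k) with psi_k in C_c^oo(O). *)
Definition H10_gradient (u : LspaceType2 m) (h : 'I_N -> LspaceType2 m) :=
  exists (v : nat -> LspaceType2 m) (w : 'I_N -> nat -> LspaceType2 m),
    [/\ forall k, exists psi,
          [/\ test_function O psi,
              (v k : _ -> R) = psi %[ae m] &
              forall i, (w i k : _ -> R) = partial i psi %[ae m]],
        v @ \oo --> u &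
        forall i, w i @ \oo --> h i].

(* Graph of the Laplacian with Dirichlet boundary conditions in L^2(O):
   u in H^1_0(O) and w = Laplacian(u) in the sense of distributions in O.
   For O = R^N, this is the Laplacian with domain H^2(R^N). *)
Definition dirichlet_laplacian (u w : LspaceType2 m) :=
  exists2 h, H10_gradient u h &
    forall psi, test_function O psi ->
      \int[m]_x (w x * psi x) =
      - \sum_(i < N) \int[m]_x (h i x * partial i psi x).

Definition laplacian_minus (mu : R) (u w : LspaceType2 m) :=
  dirichlet_laplacian u (w + mu *: u).
End laplacian.
Arguments laplacian_minus {R N} m O mu u w.

Section euclidean.
Variables (R : realType) (N : nat).

Definition enorm (x : 'rV[R]_N) : R := Num.sqrt (\sum_i x ord0 i ^+ 2).

Definition eball (K : R) : set 'rV[R]_N := [set x | enorm x < K].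

Lemma measurable_eball K : measurable (eball K).
Proof.
have mE : measurable_fun setT enorm.
  apply: (@measurableT_comp _ _ _ _ _ _ (@Num.sqrt R)).
    by apply: continuous_measurable_fun; exact: sqrt_continuous.
  apply: measurable_sum => i.
  exact: measurable_funX (measurable_coor i).
have -> : eball K = enorm @^-1` `]-oo, K[.
  by apply/funext => x; rewrite /eball /= in_itv.
by rewrite -[X in measurable X]setTI; exact: mE.
Qed.

Definition lebesgue_eball (K : R) : {measure set 'rV[R]_N -> \bar R} :=
  mrestr (lebesgue_rV R N) (measurable_eball K).
End euclidean.
Arguments eball {R} N K.
Arguments lebesgue_eball {R} N K.

Notation L2_space R N := (LspaceType2 (lebesgue_rV R N)).
(* L^2 of the ball: classes of functions on R^N modulo equality almost
   everywhere in the ball. *)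
Notation L2_ball N K := (LspaceType2 (lebesgue_eball N K)).

(* A real operator A on V is extended to the complexification of V, whose
   element x.1 + i x.2 is represented by the pair x. *)
Section spectrum.
Variables (R : realType) (V : normedModType R) (A : V -> V -> Prop).

Definition cscale (z : R[i]) (x : V * V) : V * V :=
  let a : R := complex.Re z in let b : R := complex.Im z in
  (a *: x.1 - b *: x.2, a *: x.2 + b *: x.1).

Definition cgraph (x y : V * V) := A x.1 y.1 /\ A x.2 y.2.

Definition eigenvalue_of (l : R[i]) :=
  exists2 x, x != 0 & cgraph x (cscale l x).

Fixpoint ker_power (l : R[i]) (k : nat) (x : V * V) : Prop :=
  if k is k'.+1 then exists2 y, cgraph x y & ker_power l k' (y - cscale l x)
  else x = 0.

Definition gen_eigenspace (l : R[i]) : set (V * V) :=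
  [set x | exists k, ker_power l k x].

Definition has_cdim (E : set (V * V)) (n : nat) :=
  exists e : 'I_n -> V * V,
    (forall c : 'I_n -> R[i], \sum_i cscale (c i) (e i) = 0 ->
       forall i, c i = 0) /\
    E = [set \sum_i cscale (c i) (e i) | c in [set: 'I_n -> R[i]]].

(* rho 1 > rho 2 > ... are the distinct real parts of the eigenvalues
   (rho 0 is junk). *)
Definition real_parts (rho : nat -> R) :=
  (forall j, (0 < j)%N -> rho j.+1 < rho j) /\
  [set rho j | j in [set j | (0 < j)%N]] =
  [set complex.Re l | l in [set l | eigenvalue_of l]].

Definition real_part_multiplicity (rho : nat -> R) (n : nat -> nat) :=
  forall j, (0 < j)%N -> exists (s : seq R[i]) (a : R[i] -> nat),
    [/\ uniq s,
        forall l, l \in s <-> eigenvalue_of l /\ complex.Re l = rho j,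
        forall l, l \in s -> has_cdim (gen_eigenspace l) (a l) &
        n j = (\sum_(l <- s) a l)%N].

Definition leading_eigenvalues (rho : nat -> R) (m : nat) : set R[i] :=
  [set l | eigenvalue_of l /\ exists2 j, (1 <= j <= m)%N & complex.Re l = rho j].

Definition gen_eigenspaces (L : set R[i]) : set (V * V) :=
  [set x | exists (s : seq R[i]) (y : R[i] -> V * V),
     (forall l, l \in s -> L l /\ gen_eigenspace l (y l)) /\
     x = \sum_(l <- s) y l].

Definition resolvent_at (z : R[i]) (T : V * V -> V * V) :=
  continuous T /\ forall x y, T x = y <-> cgraph y (cscale z y - x).

(* p x = (2 pi i)^-1 * (integral of (z - A)^-1 x dz over |z - l| = r) for all
   sufficiently small radii r. *)
Definition riesz_projection (l : R[i]) (p : V * V -> V * V) :=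
  exists2 r0 : R, 0 < r0 & forall r, 0 < r < r0 ->
    exists T : R -> V * V -> V * V,
      (forall th, resolvent_at (l + Complex (r * cos th) (r * sin th)) (T th)) /\
      forall x, is_Rint
        (fun th => cscale (Complex (r * cos th / (2 * pi))
                                   (r * sin th / (2 * pi))) (T th x))
        0 (2 * pi) (p x).

Definition spectral_projection (L : set R[i]) (P : V -> V) :=
  [/\ linear P, continuous P,
      exists (s : seq R[i]) (p : R[i] -> V * V -> V * V),
        [/\ uniq s, forall l, l \in s <-> L l,
            forall l, l \in s -> riesz_projection l (p l) &
            forall x, (P x.1, P x.2) = \sum_(l <- s) p l x] &
      [set (P x.1, P x.2) | x in [set: V * V]] = gen_eigenspaces L].
End spectrum.

(* Main.v *)
(* The hypothesis eta < 1 is so strong that the attractor is a single point.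
   Its first term forces t_0 >= tau: for t_0 < tau the histories supported in
   [t_0 - tau, 0] are merely translated by U(t_0), and as P has finite rank some
   of them lie in its kernel, so that K_m exp(rho_m t_0) >= 1.  Given t_0 >= tau,
   the third term forces mu > 2 sigma + 1 + L_f^2 >= sigma + L_f.  Since the
   semigroup S decays like exp(- mu t) (its generator is dissipative), variation
   of constants then makes Phi(2 tau) a strict contraction, and an invariant
   compact set of a strict contraction has at most one point.  Its dimension is
   0, while the bound is positive because k_m >= 1 and 0 < eta < 1. *)

Require Import Defs.
From HB Require Import structures.
From mathcomp Require Import all_boot all_order all_algebra.
From mathcomp Require Import all_classical all_reals all_analysis.
From mathcomp Require Import measurable_realfun ess_sup_inf ring lra.
From mathcomp.real_closed Require Import complex.
Set Implicit Arguments.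
Unset Strict Implicit.
Unset Printing Implicit Defensive.
Import Order.TTheory GRing.Theory Num.Theory numFieldNormedType.Exports.
Local Open Scope classical_set_scope.
Local Open Scope ring_scope.

(** The decay of [S] must be extracted from bare data: a semigroup that is right continuous at 0,
    together with the graph of its generator. Local boundedness, a dense domain and left continuity
    of orbits are not given. One source replaces them: up to time [tau], the mild solution with
    constant history [x] contains the Riemann integral of the orbit of [x]. An integrable orbit is
    bounded; its integrals over short intervals lie in the domain, have left continuous orbits and,
    divided by the length, converge to [x]. The energy estimate is run on these integrals.

    The time [2 * tau] leaves room for one delay interval without gain: the contraction factor at
    time [t] is [q + (1 - q) exp(- mu t)] with [q = (sigma + L_f) / mu], which tends to 1 as [t]
    tends to 0. It is uniformly below 1 only on the second interval.

    The sign of [L_f] is not assumed. It follows from the existence of a nonzero vector, which in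
    turn comes from an eigenvector of the generator of [U]. *)

(** * The inner product of L2 *)

Section L2_dot.
Context d (T : measurableType d) (R : realType).
Variable m : {measure set T -> \bar R}.
Local Notation V := (LspaceType2 m).
Implicit Types u v w : V.

Definition dot u v : R := \int[m]_x (u x * v x).

Lemma integrable_mul2 u v : m.-integrable setT (EFin \o (fun x => u x * v x)).
Proof.
by apply/Lfun1_integrable; apply: Lfun2_mul_Lfun1; exact: LspaceP.
Qed.

Lemma ae_eq_Rintegral (h1 h2 : T -> R) :
  measurable_fun setT h1 -> measurable_fun setT h2 -> h1 = h2 %[ae m] ->
  \int[m]_x h1 x = \int[m]_x h2 x.
Proof.
move=> m1 m2 h12; congr fine; apply: ae_eq_integral => //.
- exact/measurable_EFinP.
- exact/measurable_EFinP.
- by apply: filterS h12 => x /= h xT; rewrite h.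
Qed.

Lemma Lspace_addE u v : ((u + v : V) : T -> R) = (fun x => u x + v x) %[ae m].
Proof.
apply: filterS (LclsE (Lrep u + Lrep v)) => x /= h xT.
by rewrite -[LHS]/((Lcls (Lrep u + Lrep v) : T -> R) x) h// LfunD !LrepE.
Qed.

Lemma Lspace_scaleE (a : R) u :
  ((a *: u : V) : T -> R) = (fun x => a * u x) %[ae m].
Proof.
apply: filterS (LclsE (a *: Lrep u)) => x /= h xT.
by rewrite -[LHS]/((Lcls (a *: Lrep u) : T -> R) x) h// LfunZ !LrepE.
Qed.

Lemma dotC u v : dot u v = dot v u.
Proof. by rewrite /dot; under eq_Rintegral do rewrite mulrC. Qed.

Lemma dotDr u v w : dot u (v + w) = dot u v + dot u w.
Proof.
rewrite /dot -RintegralD//; [|exact: integrable_mul2..].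
apply: ae_eq_Rintegral.
- by apply: measurable_funM; exact: Lspace_measurable.
- by apply: measurable_funD; apply: measurable_funM; exact: Lspace_measurable.
- by apply: filterS (Lspace_addE v w) => x /= h xT; rewrite h// mulrDr.
Qed.

Lemma dotZr a u v : dot u (a *: v) = a * dot u v.
Proof.
rewrite /dot -RintegralZl//; last exact: integrable_mul2.
apply: ae_eq_Rintegral.
- by apply: measurable_funM; exact: Lspace_measurable.
- by apply: measurable_funM => //; apply: measurable_funM; exact: Lspace_measurable.
- by apply: filterS (Lspace_scaleE a v) => x /= h xT; rewrite h// mulrCA.
Qed.

Lemma dotDl u v w : dot (v + w) u = dot v u + dot w u.
Proof. by rewrite dotC dotDr !(dotC u). Qed.

Lemma dotZl a u v : dot (a *: v) u = a * dot v u.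
Proof. by rewrite dotC dotZr dotC. Qed.

Lemma dotNr u v : dot u (- v) = - dot u v.
Proof. by rewrite -scaleN1r dotZr mulN1r. Qed.

Lemma dotBr u v w : dot u (v - w) = dot u v - dot u w.
Proof. by rewrite dotDr dotNr. Qed.

Lemma dotBl u v w : dot (v - w) u = dot v u - dot w u.
Proof. by rewrite dotC dotBr !(dotC u). Qed.

Lemma dot_sqr u : dot u u = `|u| ^+ 2.
Proof.
apply: EFin_inj; rewrite /dot /Rintegral fineK; last first.
  by apply: integrable_fin_num => //; exact: integrable_mul2.
have -> : (`|u| ^+ 2)%:E = ('N[m]_2%:E[EFin \o (u : T -> R)] `^ 2)%E.
  have -> : 'N[m]_2%:E[EFin \o (u : T -> R)]%E = (`|u|)%:E.
    rewrite Lspace_normrE fineK// ge0_fin_numE ?Lnorm_ge0//.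
    exact: Lspace_finite.
  by rewrite poweR_EFin powR_mulrn.
rewrite powR_Lnorm//; apply: eq_integral => x _ /=.
by rewrite -expr2 -real_normK ?num_real// powR_mulrn.
Qed.

Lemma dot_sqrB u v : `|u - v| ^+ 2 = `|u| ^+ 2 - 2 * dot u v + `|v| ^+ 2.
Proof.
rewrite -!dot_sqr dotBr !dotBl (dotC v u); ring.
Qed.

(** Cauchy-Schwarz: the squared norm of [|v| u - |u| v] expands to [2 |u| |v|] times the difference
    of the two sides. *)
Lemma dot_le u v : dot u v <= `|u| * `|v|.
Proof.
have [u0|u0] := eqVneq u 0.
  by rewrite u0 normr0 mul0r -(scale0r 0) dotZl mul0r.
have [v0|v0] := eqVneq v 0.
  by rewrite v0 normr0 mulr0 -(scale0r 0) dotZr mul0r.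
have up : 0 < `|u| by rewrite normr_gt0.
have vp : 0 < `|v| by rewrite normr_gt0.
have := sqr_ge0 `| (`|v| *: u) - `|u| *: v |.
rewrite dot_sqrB dotZl dotZr !normrZ !normr_id => h.
have uv : 0 < `|u| * `|v| by exact: mulr_gt0.
rewrite -(ler_pM2l uv); nra.
Qed.

Lemma dot_norm_le u v : `|dot u v| <= `|u| * `|v|.
Proof.
by rewrite ler_norml dot_le andbT lerNl -dotNr -[X in _ <= _ * X]normrN dot_le.
Qed.

Lemma cvg_dot (I : Type) (F : set_system I) {FF : Filter F} (v w : I -> V)
    (a b : V) :
  v @ F --> a -> w @ F --> b -> dot (v k) (w k) @[k --> F] --> dot a b.
Proof.
move=> va wb; apply/cvgrPdist_le => e e0.
have vab : `|a - v k| * (`|b| + 1) + `|a| * `|b - w k| @[k --> F] -->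
    0 * (`|b| + 1) + `|a| * 0.
  apply: cvgD; apply: cvgM; try exact: cvg_cst.
    by rewrite -(normr0 V) -(subrr a); apply: cvg_norm; apply: cvgB => //; exact: cvg_cst.
  by rewrite -(normr0 V) -(subrr b); apply: cvg_norm; apply: cvgB => //; exact: cvg_cst.
rewrite mul0r mulr0 addr0 in vab.
have wb1 : \forall k \near F, `|b - w k| < 1.
  by move/cvgr_dist_lt : wb; apply.
have ab0 : \forall k \near F, `|a - v k| * (`|b| + 1) + `|a| * `|b - w k| < e.
  have /cvgr_dist_lt/(_ e e0) := vab.
  by apply: filterS => k; rewrite sub0r normrN; apply: le_lt_trans; exact: ler_norm.
apply: filterS2 wb1 ab0 => k w1 ab.
have -> : dot a b - dot (v k) (w k) = dot (a - v k) (w k) + dot a (b - w k).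
  by rewrite dotBl dotBr; ring.
apply: le_trans (ler_normD _ _) _; apply: le_trans (ltW ab).
apply: lerD; last exact: dot_norm_le.
apply: le_trans (dot_norm_le _ _) _; apply: ler_wpM2l => //.
rewrite -[w k](subrK b); apply: le_trans (ler_normD _ _) _.
by rewrite addrC lerD2l distrC ltW.
Qed.

End L2_dot.

(** * Measurability of test functions, and dissipativity of the Laplacian *)

Section rV_continuous_measurable.
Variables (R : realType) (n : nat).

(** The sigma-algebra is generated by the coordinates, so [U] is exhausted by the countably many
    boxes with rational centre and radius [1 / (k + 1)] that it contains. Two points of a box are
    less than twice its radius apart in each coordinate, whence the radius below [e / 2]. *)
Lemma measurable_open_rV (U : set 'rV[R]_n) : open U -> measurable U.
Proof.
move=> oU.
pose box (qk : 'rV[rat]_n * nat) : set 'rV[R]_n :=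
  \bigcap_(i in [set: 'I_n])
    ((fun x : 'rV[R]_n => x ord0 i) @^-1` ball (ratr (qk.1 ord0 i) : R) qk.2.+1%:R^-1).
have mbox qk : measurable (box qk).
  apply: fin_bigcap_measurable; first exact: finite_finset.
  move=> i _; rewrite -[X in measurable X]setTI.
  by apply: measurable_coor => //; exact: measurable_ball.
have -> : U = \bigcup_qk (if `[<box qk `<=` U>] then box qk else set0).
  apply/seteqP; split => [x Ux|x [qk _]]; last by case: asboolP => // h; exact: h.
  have /nbhs_ballP[e /= e0 xeU] : nbhs x U by exact: open_nbhs_nbhs.
  have [k ke] : exists k : nat, k.+1%:R^-1 < e / 2.
    have e2 : 0 < e / 2 by exact: divr_gt0.
    exists (Num.truncn (e / 2)^-1); rewrite invf_plt ?posrE//.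
    by rewrite truncnS_gt.
  have [c cE] : exists c : R, c = k.+1%:R^-1 by eexists.
  have c0 : 0 < c by rewrite cE invr_gt0.
  rewrite -cE in ke.
  have xq i : exists q : rat, `|x ord0 i - ratr q| < c.
    have [|q] := @rat_in_itvoo R (x ord0 i - c) (x ord0 i + c); first by lra.
    by rewrite in_itv/= => /andP[h1 h2]; exists q; rewrite ltr_norml; lra.
  have [q hq] := choice xq.
  have bx : box (\row_i q i, k) x.
    by move=> i _ /=; rewrite -ball_normE /= mxE distrC -cE; exact: hq.
  exists (\row_i q i, k) => //; case: asboolP => // -[] y by_.
  apply: xeU; split=> // i j; rewrite (ord1 i) -ball_normE /=.
  have := by_ j I; have := bx j I.
  rewrite /= -!ball_normE /= -cE => hx hy.
  have -> : x ord0 j - y ord0 j = (ratr ((\row_i q i) ord0 j) - y ord0 j)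
     - (ratr ((\row_i q i) ord0 j) - x ord0 j) by ring.
  apply: le_lt_trans (ler_normB _ _) _; lra.
apply: countable_bigcupT_measurable => [|qk]; first exact: countableP.
by case: asboolP.
Qed.

Lemma continuous_measurable_rV (psi : 'rV[R]_n -> R) :
  continuous psi -> measurable_fun setT psi.
Proof.
move=> cpsi; apply: (measurability (@RGenOpens.G R) (RGenOpens.measurableE R)).
move=> _ [_ [a [b ->]] <-]; rewrite setTI; apply: measurable_open_rV.
by move/continuousP : cpsi; apply; exact: interval_open.
Qed.

End rV_continuous_measurable.

(** The weak formulation accepts only test functions, so it is applied to those that approximate [u]
    in H^1_0. In the limit the pairing of the Laplacian of [u] with [u] equals minus the sum of the
    [|h i|^2]. *)
Lemma laplacian_minus_dissipative (R : realType) (n : nat)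
    (m : {measure set 'rV[R]_n -> \bar R}) (O : set 'rV[R]_n) (mu : R)
    (u w : LspaceType2 m) :
  laplacian_minus m O mu u w -> dot u w <= - mu * `|u| ^+ 2.
Proof.
move=> -[h [v [wk [vwk vu wkh]]] weak].
suff : dot (w + mu *: u) u <= 0.
  by rewrite dotDl dotZl dot_sqr (dotC w) => ?; lra.
have cu : dot (w + mu *: u) (v k) @[k --> \oo] --> dot (w + mu *: u) u.
  by apply: cvg_dot => //; exact: cvg_cst.
have ch : - (\sum_(i < n) dot (h i) (wk i k)) @[k --> \oo] -->
    - (\sum_(i < n) dot (h i) (h i)).
  apply: cvgN; apply: cvg_big => [|i _]; first exact: add_continuous.
  apply: cvg_dot; first exact: cvg_cst.
  exact: wkh.
have E k : dot (w + mu *: u) (v k) = - (\sum_(i < n) dot (h i) (wk i k)).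
  have [psi [tpsi vpsi wpsi]] := vwk k.
  have mpsi : measurable_fun setT psi.
    by apply: continuous_measurable_rV; exact: (tpsi.1 0%N).1.
  have mdpsi i : measurable_fun setT (partial i psi).
    by apply: continuous_measurable_rV; exact: ((tpsi.1 1%N).2 i).2.1.
  transitivity (\int[m]_x ((w + mu *: u : LspaceType2 m) x * psi x)).
    apply: ae_eq_Rintegral.
    - by apply: measurable_funM; exact: Lspace_measurable.
    - by apply: measurable_funM => //; exact: Lspace_measurable.
    - by apply: filterS vpsi => x e xT; congr (_ * _); have := e xT; by [].
  rewrite weak//; congr (- _); apply: eq_bigr => i _; apply: ae_eq_Rintegral.
  - by apply: measurable_funM => //; exact: Lspace_measurable.
  - by apply: measurable_funM => //; exact: Lspace_measurable.
  - by apply: filterS (wpsi i) => x e xT; congr (_ * _); have := e xT; by [].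
have /funext E' := E.
rewrite E' in cu.
rewrite (cvg_unique (@norm_hausdorff _ _) cu ch).
rewrite oppr_le0; apply: sumr_ge0 => i _; rewrite dot_sqr; exact: sqr_ge0.
Qed.

(** * Riemann integrals of vector-valued functions *)

Section Riemann.
Variables (R : realType) (V : normedModType R).
Implicit Types (h k : R -> V) (J : V).

Lemma uniform_step (a b delta : R) : a <= b -> 0 < delta ->
  exists (n : nat) (c : R), [/\ (0 < n)%N, c * n%:R = b - a, 0 <= c & c < delta].
Proof.
move=> ab d0; pose n := (Num.truncn ((b - a) / delta)).+1.
exists n, ((b - a) / n%:R).
have n0 : 0 < n%:R :> R by rewrite ltr0n.
split => //.
- by rewrite divfK// gt_eqF.
- by rewrite divr_ge0 ?subr_ge0// ltW.
- by rewrite ltr_pdivrMr// mulrC -ltr_pdivrMr// truncnS_gt.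
Qed.

Lemma uniform_step_itv (a b c : R) (n i : nat) : c * n%:R = b - a -> 0 <= c ->
  (i <= n)%N -> a <= a + c * i%:R <= b.
Proof.
move=> cn c0; rewrite -(ler_nat R) => iN.
have := ler_wpM2l c0 iN; rewrite cn => h.
by rewrite lerDl mulr_ge0//=; lra.
Qed.

Lemma Rint_left_sum h a b J : is_Rint h a b J ->
  forall e, 0 < e -> exists2 delta, 0 < delta &
  forall (n : nat) (c : R), c * n%:R = b - a -> 0 <= c -> c < delta ->
    `|\sum_(i < n) c *: h (a + c * i%:R) - J| < e.
Proof.
move=> hJ e e0; have [delta d0 hd] := hJ e e0; exists delta => // n c cn c0 cd.
have := hd n (fun i => a + c * i%:R) (fun i => a + c * i%:R).
have st (i : nat) : a + c * i.+1%:R - (a + c * i%:R) = c by rewrite -natr1; ring.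
under eq_bigr do rewrite st.
apply; first by rewrite mulr0 addr0.
- by rewrite cn; ring.
- by move=> i iN; rewrite st lexx/= -subr_ge0 st.
Qed.

Lemma Rint_linear_comp (T : V -> V) h a b J : linear T -> continuous T ->
  is_Rint h a b J -> is_Rint (fun s => T (h s)) a b (T J).
Proof.
move=> lT cT hJ e e0.
pose L : {linear V -> V} := HB.pack T (GRing.isLinear.Build _ _ _ _ T lT).
have /cvgrPdist_lt/(_ e e0)/nbhs_ballP[eta /= eta0 heta] := cT J.
have [delta d0 hd] := hJ eta eta0; exists delta => // n t s t0 tn ts.
have -> : \sum_(i < n) (t i.+1 - t i) *: T (h (s i)) =
    L (\sum_(i < n) (t i.+1 - t i) *: h (s i)).
  by rewrite linear_sum; apply: eq_bigr => i _; rewrite linearZ.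
rewrite distrC; apply: heta; rewrite -ball_normE /= distrC; exact: hd.
Qed.

Lemma Rint_shift h a b c J : is_Rint (fun s => h (s + c)) a b J ->
  is_Rint h (a + c) (b + c) J.
Proof.
move=> hJ e e0; have [delta d0 hd] := hJ e e0; exists delta => // n t s t0 tn ts.
have := hd n (fun i => t i - c) (fun i => s i - c).
have st (i : nat) : t i.+1 - c - (t i - c) = t i.+1 - t i by ring.
under eq_bigr do rewrite st subrK.
apply; rewrite ?t0 ?tn ?addrK//.
by move=> i iN; have [/andP[? ?] ?] := ts i iN; rewrite st !lerD2r; split => //; apply/andP.
Qed.

Lemma Rint_sub h k a b J J' : is_Rint h a b J -> is_Rint k a b J' ->
  is_Rint (fun s => h s - k s) a b (J - J').
Proof.
move=> hJ kJ e e0.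
have [d1 d10 h1] := hJ _ (divr_gt0 e0 (ltr0n R 2)).
have [d2 d20 h2] := kJ _ (divr_gt0 e0 (ltr0n R 2)).
exists (Num.min d1 d2); first by rewrite lt_min d10.
move=> n t s t0 tn ts.
have A d' : Num.min d1 d2 <= d' -> forall i, (i < n)%N ->
    t i <= s i <= t i.+1 /\ t i.+1 - t i < d'.
  by move=> dd i iN; have [? l] := ts i iN; split => //; exact: lt_le_trans l dd.
have {}h1 := h1 n t s t0 tn (A d1 ltac:(by rewrite ge_min lexx)).
have {}h2 := h2 n t s t0 tn (A d2 ltac:(by rewrite ge_min lexx orbT)).
have -> : \sum_(i < n) (t i.+1 - t i) *: (h (s i) - k (s i)) - (J - J') =
  (\sum_(i < n) (t i.+1 - t i) *: h (s i) - J) -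
  (\sum_(i < n) (t i.+1 - t i) *: k (s i) - J').
  under eq_bigr do rewrite scalerBr.
  by rewrite sumrB !opprB addrACA [in RHS]addrACA; congr (_ + _); rewrite addrC.
apply: le_lt_trans (ler_normB _ _) _; lra.
Qed.

Lemma Rint_ext h k a b J : (forall s, a <= s <= b -> h s = k s) ->
  is_Rint h a b J -> is_Rint k a b J.
Proof.
move=> hk hJ e e0; have [d d0 hd] := hJ e e0; exists d => // n t s t0 tn ts.
have tm i j : (i <= j)%N -> (j <= n)%N -> t i <= t j.
  elim: j => [|j IH]; first by rewrite leqn0 => /eqP ->.
  rewrite leq_eqVlt => /predU1P[-> //|ij] jn.
  apply: le_trans (IH ij (ltnW jn)) _.
  by have [/andP[h1 h2] _] := ts j jn; exact: le_trans h2.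
suff -> : \sum_(i < n) (t i.+1 - t i) *: k (s i) =
          \sum_(i < n) (t i.+1 - t i) *: h (s i) by exact: hd.
apply: eq_bigr => i _; rewrite hk//.
have [/andP[h1 h2] _] := ts i (ltn_ord i).
rewrite -t0 -tn (le_trans _ h1) ?tm ?(ltnW (ltn_ord i))//=.
by rewrite (le_trans h2) ?tm.
Qed.

Lemma Rint_cst (x : V) a b : is_Rint (fun=> x) a b ((b - a) *: x).
Proof.
move=> e e0; exists 1 => // n t s t0 tn _.
rewrite -scaler_suml -(big_mkord xpredT (fun i => t i.+1 - t i)).
by rewrite telescope_sumr// t0 tn subrr normr0.
Qed.

(* Left tags suffice: the Riemann sum is then dominated by a telescoping sum. *)
Lemma Rint_norm_le h a b J (G : R -> R) : a <= b -> is_Rint h a b J ->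
  (forall p q, a <= p -> p <= q -> q <= b -> (q - p) * `|h p| <= G q - G p) ->
  `|J| <= G b - G a.
Proof.
move=> ab hJ hG; apply/ler_addgt0Pr => e e0.
have [d d0 hd] := Rint_left_sum hJ e0.
have [n [c [n0 cn c0 cd]]] := uniform_step ab d0.
have := hd n c cn c0 cd; set s := \sum_(i < n) _ => sJ.
have sle : `|s| <= G b - G a.
  apply: le_trans (ler_norm_sum _ _ _) _.
  have -> : G b - G a = \sum_(i < n) (G (a + c * i.+1%:R) - G (a + c * i%:R)).
    rewrite -(big_mkord xpredT (fun i => G (a + c * i.+1%:R) - G (a + c * i%:R))).
    rewrite (telescope_sumr (fun i : nat => G (a + c * i%:R)))//.
    by rewrite cn mulr0 addr0 subrKC.
  apply: ler_sum => i _; rewrite normrZ (ger0_norm c0).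
  have st : c = a + c * i.+1%:R - (a + c * i%:R) by rewrite -natr1; ring.
  rewrite {1}st; apply: hG.
  - by have /andP[] := uniform_step_itv cn c0 (ltnW (ltn_ord i)).
  - by rewrite -subr_ge0 -st.
  - by have /andP[] := uniform_step_itv cn c0 (ltn_ord i).
have -> : J = s - (s - J) by rewrite subKr.
by apply: le_trans (ler_normB _ _) _; apply: lerD => //; exact: ltW.
Qed.

Lemma Rint_norm_le_cst h a b J (C : R) : a <= b -> is_Rint h a b J ->
  (forall s, a <= s <= b -> `|h s| <= C) -> `|J| <= C * (b - a).
Proof.
move=> ab hJ hC; rewrite mulrBr.
apply: (Rint_norm_le (G := fun s => C * s) ab hJ) => p q ap pq qb.
rewrite -mulrBr mulrC ler_wpM2r ?subr_ge0//.
by apply: hC; rewrite ap (le_trans pq).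
Qed.

Lemma Rint_concat h a b c J1 J2 J : a <= b -> b <= c ->
  is_Rint h a b J1 -> is_Rint h b c J2 -> is_Rint h a c J -> J = J1 + J2.
Proof.
move=> ab bc h1 h2 hJ; apply/eqP; rewrite -subr_eq0 -normr_le0.
apply/ler_addgt0Pr => e e0; rewrite add0r.
have e3 : 0 < e / 3 by rewrite divr_gt0.
have [d1 d10 H1] := Rint_left_sum h1 e3.
have [d2 d20 H2] := Rint_left_sum h2 e3.
have [d3 d30 H3] := hJ _ e3.
have m1 : 0 < Num.min d1 d3 by rewrite lt_min d10.
have m2 : 0 < Num.min d2 d3 by rewrite lt_min d20.
have [n1 [c1 [n10 cn1 c10]]] := uniform_step ab m1.
rewrite lt_min => /andP[cd1 cd13].
have [n2 [c2 [n20 cn2 c20]]] := uniform_step bc m2.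
rewrite lt_min => /andP[cd2 cd23].
have {}H1 := H1 n1 c1 cn1 c10 cd1; have {}H2 := H2 n2 c2 cn2 c20 cd2.
(* The two uniform partitions are glued at index [n1], where both formulas give [b]. Both steps are
   also below [d3], so the result is admissible for the integral over [[a, c]]. *)
pose t (i : nat) : R := if (i <= n1)%N then a + c1 * i%:R else b + c2 * (i - n1)%:R.
have tl i : (i <= n1)%N -> t i = a + c1 * i%:R by rewrite /t => ->.
have tr i : t (n1 + i)%N = b + c2 * i%:R.
  rewrite /t; case: i => [|i]; last by rewrite leqNgt {1}addnS ltnS leq_addr/= addKn.
  by rewrite addn0 leqnn cn1 mulr0 addr0; ring.
have tSl i : (i < n1)%N -> t i.+1 - t i = c1.
  by move=> ?; rewrite !tl// 1?ltnW// -natr1; ring.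
have tSr i : t (n1 + i).+1 - t (n1 + i)%N = c2.
  by rewrite -addnS !tr -natr1; ring.
have {}H3 : `|\sum_(i < n1 + n2) (t i.+1 - t i) *: h (t i) - J| < e / 3.
  apply: H3.
  - by rewrite tl// mulr0 addr0.
  - by rewrite tr cn2; ring.
  - move=> i iN; rewrite lexx/= -subr_ge0; case: (ltnP i n1) => i1.
      by rewrite tSl.
    by rewrite -(subnKC i1) tSr.
rewrite big_split_ord/= in H3.
move: H3.
under eq_bigr => i _ do rewrite tSl// tl ?(ltnW (ltn_ord i))//.
under [X in _ + X - _]eq_bigr => i _ do rewrite tSr tr.
move: H1 H2; set s1 := \sum_(i < n1) _; set s2 := \sum_(i < n2) _ => H1 H2 H3.
have -> : J - (J1 + J2) = ((s1 - J1) + (s2 - J2)) - (s1 + s2 - J).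
  by rewrite addrACA -opprD opprB [RHS]addrC addrA subrK.
apply: le_trans (ler_normB _ _) _.
apply: le_trans (lerD (ler_normD _ _) (lexx _)) _; lra.
Qed.

(** Moving a single tag from the node [t i] to [s] changes the Riemann sum by [c (h s - h (t i))].
    Both sums are within 1 of [J], so [h s] is within [2 / c] of one of finitely many node
    values. *)
Lemma Rint_bounded h a b J : a < b -> is_Rint h a b J ->
  exists M, forall s, a <= s <= b -> `|h s| <= M.
Proof.
move=> ab hJ; have [d d0 hd] := hJ 1 ltr01.
have [n [c [n0 cn c0 cd]]] := uniform_step (ltW ab) d0.
have cp : 0 < c.
  rewrite lt_neqAle c0 andbT; apply/eqP => cE.
  by move: cn; rewrite -cE mul0r => /esym/eqP; rewrite subr_eq0 gt_eqF.
pose t (i : nat) := a + c * i%:R.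
have tS i : t i.+1 - t i = c by rewrite /t -natr1; ring.
have t0 : t 0%N = a by rewrite /t mulr0 addr0.
have tn : t n = b by rewrite /t cn subrKC.
exists (2 / c + \sum_(i < n) `|h (t i)|) => s /andP[as_ sb].
have [i iN /andP[tis sti]] : exists2 i, (i < n)%N & t i <= s <= t i.+1.
  have : s <= t n by rewrite tn.
  elim: n n0 {cn tn hd} => // -[|k] IH _ sk.
    by exists 0%N; rewrite // t0 as_.
  have [ks|ks] := leP s (t k.+1).
    by have [i ik ?] := IH isT ks; exists i => //; exact: ltnW.
  by exists k.+1 => //; rewrite ltW.
have A1 : forall i, (i < n)%N -> t i <= t i <= t i.+1 /\ t i.+1 - t i < d.
  by move=> j _; rewrite lexx -subr_ge0 tS c0.
have A2 : forall j, (j < n)%N ->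
    t j <= (if j == i then s else t j) <= t j.+1 /\ t j.+1 - t j < d.
  move=> j jn; case: eqP => [->|_]; last exact: A1.
  by rewrite tis sti tS.
have := hd n t t t0 tn A1; have := hd n t _ t0 tn A2.
set s2 := \sum_(j < n) _; set s1 := \sum_(j < n) _ => h2 h1.
have s12 : s2 - s1 = c *: (h s - h (t i)).
  rewrite /s2 /s1 -sumrB (bigD1 (Ordinal iN))//= eqxx big1 ?addr0.
    by rewrite tS scalerBr.
  move=> j; rewrite -val_eqE /= => /negPf ->; exact: subrr.
have : `|s2 - s1| <= 2.
  have -> : s2 - s1 = (s2 - J) - (s1 - J) by rewrite opprB addrA subrK.
  apply: le_trans (ler_normB _ _) _; lra.
rewrite s12 normrZ gtr0_norm// mulrC -ler_pdivlMr// => hs.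
rewrite -[h s](subrK (h (t i))); apply: le_trans (ler_normD _ _) _.
apply: lerD => //; rewrite (bigD1 (Ordinal iN))//= lerDl.
by apply: sumr_ge0.
Qed.

End Riemann.

(** * Exponential decay of a semigroup with dissipative generator *)

(** Continuous induction on [phi r <= phi 0 + e' * r]: left continuity carries the bound to the
    supremum [c] of the times up to which it holds, and the right derivative at [c] carries it
    beyond [c] unless [c = b]. *)
Lemma right_derivative_le0 (R : realType) (phi : R -> R) (b : R) : 0 <= b ->
  (forall c, 0 < c <= b -> phi s @[s --> c^'-] --> phi c) ->
  (forall s, 0 <= s < b -> forall e, 0 < e ->
     \forall h \near 0^'+, phi (s + h) - phi s <= e * h) ->
  phi b <= phi 0.
Proof.
move=> b0 lc rd; rewrite -subr_le0; apply/ler_addgt0Pr => e e0.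
have [e' e'0 e'b] : exists2 e', 0 < e' & e' * b <= e.
  (* The denominator [b + 1] covers the case [b = 0]. *)
  exists (e / (b + 1)); first by rewrite divr_gt0// ltr_wpDl.
  by rewrite -mulrAC ler_pdivrMr ?ltr_wpDl// ler_pM2l// lerDl.
suff : phi b <= phi 0 + e' * b by move=> h; lra.
pose T := [set s | 0 <= s <= b /\ forall r, 0 <= r <= s -> phi r <= phi 0 + e' * r].
have T0 : T 0.
  split; first by rewrite lexx.
  by move=> r r0; have -> : r = 0; [apply/le_anti; rewrite andbC|rewrite mulr0 addr0].
have ubT : has_ubound T by exists b => s [/andP[]].
have hsT : has_sup T by split => //; exists 0.
set c := sup T; have c0 : 0 <= c by exact: ub_le_sup.
have cb : c <= b by apply: ge_sup; [exists 0|move=> s [/andP[]]].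
have below r : 0 <= r -> r < c -> phi r <= phi 0 + e' * r.
  rewrite -subr_gt0 => r0 rc; have [s [_ sT]] := sup_adherent rc hsT.
  by rewrite subKr => rs; apply: sT; rewrite r0 ltW.
have atc : phi c <= phi 0 + e' * c.
  move: c0; rewrite le_eqVlt => /predU1P[<-|cp]; first by rewrite mulr0 addr0.
  have cl : phi s - e' * s @[s --> c^'-] --> phi c - e' * c.
    apply: cvgB; first by apply: lc; rewrite cp.
    apply: cvg_at_left_filter; apply: cvgM; [exact: cvg_cst|exact: cvg_id].
  rewrite -lerBlDr.
  apply: (ler_cvg_to cl (cvg_cst (phi 0))); near=> s.
  rewrite lerBlDr; apply: below; first by near: s; exact: nbhs_left_ge.
  by near: s; exact: nbhs_left_lt.
have [cb'|bc] := ltP c b; last by have -> : b = c by apply/le_anti/andP.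
have := rd c _ e' e'0; rewrite c0 cb' => /(_ isT) [d /= d0 hd].
pose h := Num.min (d / 2) (b - c).
have h0 : 0 < h by rewrite lt_min subr_gt0 cb' divr_gt0.
have Tch : T (c + h).
  split; first by rewrite addr_ge0 ?(ltW h0)//= -lerBrDl ge_min lexx orbT.
  move=> r /andP[r0 rch]; have [rc|] := ltP r c; first exact: below.
  rewrite le_eqVlt => /predU1P[<-//|cr].
  have := hd (r - c); rewrite /= sub0r normrN gtr0_norm ?subr_gt0// => /(_ _ cr).
  rewrite subrKC => /(_ _) H; have {}H : phi r - phi c <= e' * (r - c).
    apply: H; apply: (@le_lt_trans _ _ h); first by rewrite lerBlDl.
    by rewrite gt_min ltr_pdivrMr// ltr_pMr// ltr1n.
  lra.
have : c + h <= c by exact: ub_le_sup.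
by rewrite gerDl leNgt h0.
Unshelve. all: by end_near. Qed.

Section semigroup_contraction.
Context d (T : measurableType d) (R : realType).
Variable m : {measure set T -> \bar R}.
Local Notation V := (LspaceType2 m).
Variables (S : R -> V -> V) (mu tau : R).
Hypothesis tau_gt0 : 0 < tau.
Hypothesis C0 : C0_semigroup S.
Hypothesis dissipative : forall x y : V, generator S x y -> dot x y <= - mu * `|x| ^+ 2.
Hypothesis integrable : forall (x : V) (t : R), 0 < t <= tau ->
  exists J : V, is_Rint (fun s => S (t - s) x) 0 t J.

Let S_linear (t : R) : 0 <= t -> linear (S t).
Proof. by have [H _ _ _] := C0; move=> /H[]. Qed.

Let S_continuous (t : R) : 0 <= t -> continuous (S t).
Proof. by have [H _ _ _] := C0; move=> /H[]. Qed.

Let SZ (t a : R) (x : V) : 0 <= t -> S t (a *: x) = a *: S t x.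
Proof.
move=> t0; pose L : {linear V -> V} := HB.pack (S t) (GRing.isLinear.Build _ _ _ _ (S t) (S_linear t0)).
by rewrite -[LHS]/(L (a *: x)) linearZ.
Qed.

Let SB (t : R) (x y : V) : 0 <= t -> S t (x - y) = S t x - S t y.
Proof.
move=> t0; pose L : {linear V -> V} := HB.pack (S t) (GRing.isLinear.Build _ _ _ _ (S t) (S_linear t0)).
by rewrite -[LHS]/(L (x - y)) linearB.
Qed.

Let S0 x : S 0 x = x. Proof. by have [_ H _ _] := C0. Qed.

Let SD (s t : R) (x : V) : 0 <= s -> 0 <= t -> S (s + t) x = S s (S t x).
Proof. by have [_ _ H _] := C0; exact: H. Qed.

Lemma generator_orbit (s : R) (x y : V) : 0 <= s -> generator S x y ->
  generator S (S s x) (S s y).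
Proof.
move=> s0 gxy; have H := continuous_cvg _ (@S_continuous s s0 y) gxy.
rewrite /generator; apply: cvg_trans (H _); apply: near_eq_cvg.
apply: filterS (nbhs_right_ge (0 : R)) => h h0.
by rewrite /= SZ// SB// -!SD// (addrC s).
Qed.

(** The right derivative at 0 of [exp(2 mu h) |S h x|^2] is [2 mu |x|^2 + 2 dot x y], which
    dissipativity makes nonpositive. *)
Lemma energy_right_derivative (x y : V) (e : R) : generator S x y -> 0 < e ->
  \forall h \near 0^'+,
    expR (2 * mu * h) * `|S h x| ^+ 2 - `|x| ^+ 2 <= e * h.
Proof.
move=> gxy e0; pose q h := h^-1 *: (S h x - x).
have cq : q h @[h --> 0^'+] --> y by exact: gxy.
have cE : expR (2 * mu * h) * (2 * mu * `|x| ^+ 2 + 2 * dot x (q h) + h * `|q h| ^+ 2)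
    @[h --> 0^'+] -->
    expR (2 * mu * 0) * (2 * mu * `|x| ^+ 2 + 2 * dot x y + 0 * `|y| ^+ 2).
  apply: cvgM.
    apply: cvg_at_right_filter; apply: continuous_comp; last exact: continuous_expR.
    by apply: cvgM; [exact: cvg_cst|exact: cvg_id].
  apply: cvgD; first apply: cvgD.
  - exact: cvg_cst.
  - by apply: cvgM; [exact: cvg_cst|apply: cvg_dot => //; exact: cvg_cst].
  - apply: cvgM; first by apply: cvg_at_right_filter; exact: cvg_id.
    by rewrite expr2; apply: cvgM; exact: cvg_norm.
rewrite mulr0 expR0 mul1r mul0r addr0 in cE.
have lt0 : 2 * mu * `|x| ^+ 2 + 2 * dot x y < e.
  by have := dissipative gxy => ?; lra.
have := cvgr_lt _ cE _ lt0 => near_e.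
near=> h.
have h0 : 0 < h by near: h; exact: nbhs_right_gt.
have He : expR (2 * mu * h) * (2 * mu * `|x| ^+ 2 + 2 * dot x (q h) + h * `|q h| ^+ 2) < e.
  by near: h; exact: near_e.
have Sx : `|S h x| ^+ 2 = `|x| ^+ 2 + h * (2 * dot x (q h) + h * `|q h| ^+ 2).
  have -> : S h x = x - (- h) *: q h.
    by rewrite scaleNr opprK scalerA divff ?gt_eqF// scale1r subrKC.
  by rewrite dot_sqrB dotZr normrZ normrN gtr0_norm//; ring.
(* This is [1 - s <= exp(- s)] at [s = 2 mu h], multiplied by [exp(s)]. *)
have E : expR (2 * mu * h) - 1 <= expR (2 * mu * h) * (2 * mu * h).
  have := expR_ge1Dx (- (2 * mu * h)); rewrite expRN.
  rewrite -(ler_pM2l (expR_gt0 (2 * mu * h))) divff ?gt_eqF ?expR_gt0//; lra.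
apply: (@le_trans _ _ (expR (2 * mu * h) *
   (2 * mu * `|x| ^+ 2 + 2 * dot x (q h) + h * `|q h| ^+ 2) * h)); last first.
  by rewrite ler_pM2r// ltW.
rewrite Sx; have := ler_wpM2r (sqr_ge0 `|x|) E; lra.
Unshelve. all: by end_near. Qed.

(** The weighted energy is nonincreasing, since [generator_orbit] moves the derivative estimate from
    time 0 to any time [s]. Left continuity is a premise because strong continuity at 0 gives it
    directly only from the right. *)
Lemma domain_decay (x y : V) (b : R) : 0 <= b -> generator S x y ->
  (forall c, 0 < c <= b -> S s x @[s --> c^'-] --> S c x) ->
  `|S b x| <= expR (- mu * b) * `|x|.
Proof.
move=> b0 gxy lc.
suff : expR (2 * mu * b) * `|S b x| ^+ 2 <= expR (2 * mu * 0) * `|S 0 x| ^+ 2.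
  rewrite mulr0 expR0 mul1r S0 => h.
  rewrite -(@ler_pXn2r _ 2)// ?nnegrE ?mulr_ge0 ?expR_ge0// exprMn -expRM_natl.
  have -> : 2%:R * (- mu * b) = - (2 * mu * b) by ring.
  by rewrite expRN -ler_pdivrMl ?invr_gt0 ?expR_gt0// invrK.
apply: (right_derivative_le0 (phi := fun s => expR (2 * mu * s) * `|S s x| ^+ 2) b0).
  move=> c cb; apply: cvgM.
    apply: cvg_at_left_filter; apply: continuous_comp; last exact: continuous_expR.
    by apply: cvgM; [exact: cvg_cst|exact: cvg_id].
  by rewrite expr2; apply: cvgM; apply: cvg_norm; exact: lc.
move=> s /andP[s0 sb] e e0.
have e'0 : 0 < e / expR (2 * mu * s) by rewrite divr_gt0// expR_gt0.
have := energy_right_derivative (generator_orbit s0 gxy) e'0 => near_e.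
near=> h.
have h0 : 0 <= h by near: h; exact: nbhs_right_ge.
have : expR (2 * mu * h) * `|S h (S s x)| ^+ 2 - `|S s x| ^+ 2 <=
  e / expR (2 * mu * s) * h by near: h; exact: near_e.
rewrite -SD// (addrC h) -(ler_pM2l (expR_gt0 (2 * mu * s))) mulrBr mulrA -expRD -mulrDr.
have -> // : expR (2 * mu * s) * (e / expR (2 * mu * s) * h) = e * h.
by rewrite mulrA [X in X * h]mulrC divfK// gt_eqF ?expR_gt0.
Unshelve. all: by end_near. Qed.

Section orbit_integral.
Variables (x : V) (K : R -> V).
Hypothesis KE : forall t : R, 0 < t <= tau -> is_Rint (fun s => S (t - s) x) 0 t (K t).

(** [K t] is the integral of [S r x] over [0 <= r <= t], in the convolution form that mild solutions
    provide. The integral for [t + h] is split at [t]: [S h] factors out of the first piece, and the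
    second is a translate of [K h]. *)
Lemma orbit_integralD (t h : R) : 0 < t -> 0 < h -> t + h <= tau ->
  K (t + h) = S h (K t) + K h.
Proof.
move=> t0 h0 th.
have tt : 0 < t <= tau by rewrite t0 (le_trans _ th)// lerDl ltW.
have hh : 0 < h <= tau by rewrite h0 (le_trans _ th)// lerDr ltW.
have tth : 0 < t + h <= tau by rewrite addr_gt0.
have I1 : is_Rint (fun s => S (t + h - s) x) 0 t (S h (K t)).
  apply: Rint_ext (Rint_linear_comp (S_linear (ltW h0)) (S_continuous (ltW h0)) (KE tt)).
  by move=> s /andP[s0 st]; rewrite -SD ?subr_ge0 ?(ltW h0)//; congr S; ring.
have I2 : is_Rint (fun s => S (t + h - s) x) t (t + h) (K h).
  rewrite -[X in is_Rint _ X](add0r t) (addrC t h); apply: Rint_shift.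
  have -> : (fun s => S (h + t - (s + t)) x) = (fun s => S (h - s) x).
    by apply/funext => s; congr S; ring.
  exact: KE.
apply: (Rint_concat (ltW t0) _ I1 I2 (KE tth)).
by rewrite lerDl ltW.
Qed.

(** A bound for each single orbit, read off from its Riemann integrability; it takes the place of a
    uniform bound on the operators. *)
Lemma orbit_bounded :
  exists2 M, 0 <= M & forall s, 0 <= s <= tau -> `|S s x| <= M.
Proof.
have tt : 0 < tau <= tau by rewrite tau_gt0 lexx.
have [M hM] := Rint_bounded tau_gt0 (KE tt).
have HM s : 0 <= s <= tau -> `|S s x| <= M.
  move=> st; have := hM (tau - s); rewrite subKr; apply; lra.
by exists M => //; apply: le_trans (HM 0 _); rewrite ?normr_ge0// lexx ltW.
Qed.

Lemma orbit_integral_norm_le M s h :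
  (forall s, 0 <= s <= tau -> `|S s x| <= M) ->
  0 <= s -> 0 < h -> s + h <= tau -> `|S s (K h)| <= M * h.
Proof.
move=> hM s0 h0 sh; rewrite -[X in _ <= _ * X]subr0.
have ht : 0 < h <= tau by rewrite h0/=; lra.
apply: Rint_norm_le_cst (ltW h0)
  (Rint_linear_comp (S_linear s0) (S_continuous s0) (KE ht)) _.
by move=> r r0h; rewrite -SD//; [apply: hM|]; lra.
Qed.

(** Since the [K h] lie in the domain of the generator, this is the density of that domain. *)
Lemma orbit_mean_cvg : h^-1 *: K h @[h --> 0^'+] --> x.
Proof.
have [_ _ _ S0x] := C0.
apply/cvgrPdist_le => e e0.
have /cvgrPdist_lt/(_ e e0)[del /= del0 hd] := S0x x.
have delt : 0 < Num.min del tau by rewrite lt_min del0.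
near=> h.
have h0 : 0 < h by near: h; exact: nbhs_right_gt.
have : h < Num.min del tau by near: h; exact: nbhs_right_lt.
rewrite lt_min => /andP[hd' ht].
have hh : 0 < h <= tau by rewrite h0 ltW.
have H := Rint_sub (KE hh) (Rint_cst x 0 h).
have := Rint_norm_le_cst (ltW h0) H (C := e); rewrite subr0 => {}H.
have -> : x - h^-1 *: K h = - h^-1 *: (K h - h *: x).
  by rewrite scalerBr !scaleNr scalerA mulVf ?gt_eqF// scale1r opprK addrC.
rewrite normrZ normrN gtr0_norm ?invr_gt0// mulrC ler_pdivrMr//.
apply: H => s /andP[s0 sh].
(* The endpoint [s = h] is separate: the limit at [0^'+] says nothing about time 0 itself. *)
have [->|sh'] := eqVneq s h; first by rewrite subrr S0 subrr normr0 ltW.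
have {}sh' : 0 < h - s by rewrite subr_gt0 lt_neqAle sh'.
rewrite distrC ltW//; apply: hd => //=.
rewrite sub0r normrN gtr0_norm//; lra.
Unshelve. all: by end_near. Qed.

(** Splitting [K (t + h)] at [t] or at [h] gives [S h (K t) - K t = S t (K h) - K h]. It remains to
    divide by [h]. *)
Lemma orbit_integral_domain t : 0 < t < tau -> generator S (K t) (S t x - x).
Proof.
move=> /andP[t0 tt]; rewrite /generator.
have H : S t (h^-1 *: K h) - h^-1 *: K h @[h --> 0^'+] --> S t x - x.
  apply: cvgB orbit_mean_cvg.
  exact: (continuous_cvg _ (@S_continuous t (ltW t0) x) orbit_mean_cvg).
apply: cvg_trans H; apply: near_eq_cvg; near=> h.
have h0 : 0 < h by near: h; exact: nbhs_right_gt.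
have ht : h < tau - t by near: h; apply: nbhs_right_lt; rewrite subr_gt0.
rewrite SZ ?(ltW t0)// -scalerBr; congr (_ *: _).
have th : t + h <= tau by lra.
have E1 := orbit_integralD t0 h0 th.
have E2 : K (t + h) = S t (K h) + K t.
  by rewrite (addrC t) orbit_integralD// addrC.
have -> : S t (K h) = K (t + h) - K t by rewrite E2 addrK.
by have -> : S h (K t) = K (t + h) - K h; [rewrite E1 addrK|exact: addrAC].
Unshelve. all: by end_near. Qed.

(** With [r = c - s], the increment [S c (K t) - S s (K t)] equals [S (t + s) (K r) - S s (K r)].
    Both terms are integrals of the bounded orbit of [x] over an interval of length [r]. *)
Lemma orbit_integral_left_continuous t c : 0 < t -> 0 < c -> t + c <= tau ->
  S s (K t) @[s --> c^'-] --> S c (K t).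
Proof.
move=> t0 c0 tc; have [M M0 hM] := orbit_bounded.
apply/cvgrPdist_le => e e0.
near=> s.
have s0 : 0 < s by near: s; exact: nbhs_left_gt.
have sc : s < c by near: s; exact: nbhs_left_lt.
have se : c - s < e / (2 * M + 1).
  by near: s; apply: nbhs_left_ltBl; rewrite divr_gt0//; lra.
pose r := c - s; have r0 : 0 < r by rewrite subr_gt0.
have E1 : K (t + c) = S (t + s) (K r) + K (t + s).
  by rewrite -orbit_integralD// /r; [congr K; ring|lra..].
have E2 : K c = S s (K r) + K s.
  by rewrite -orbit_integralD// /r; [congr K; ring|lra..].
have E3 := orbit_integralD t0 c0 tc.
have E4 : K (t + s) = S s (K t) + K s by rewrite orbit_integralD//; lra.
have -> : S c (K t) - S s (K t) = S (t + s) (K r) - S s (K r).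
  apply/eqP; rewrite subr_eq; apply/eqP.
  have -> : S c (K t) = K (t + c) - K c by rewrite E3 addrK.
  by rewrite E1 E2 E4 addrA (addrC (S s (K r))) addrKA addrAC.
apply: le_trans (ler_normB _ _) _.
have L1 := @orbit_integral_norm_le M (t + s) r hM ltac:(lra) r0 ltac:(rewrite /r; lra).
have L2 := @orbit_integral_norm_le M s r hM ltac:(lra) r0 ltac:(rewrite /r; lra).
apply: le_trans (lerD L1 L2) _.
move: se; rewrite -/r ltr_pdivlMr; last lra.
by move=> se; nra.
Unshelve. all: by end_near. Qed.

Lemma orbit_decay s : 0 <= s < tau -> `|S s x| <= expR (- mu * s) * `|x|.
Proof.
move=> /andP[s0 st].
have cS : `|S s (h^-1 *: K h)| @[h --> 0^'+] --> `|S s x|.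
  apply: cvg_norm.
  exact: (continuous_cvg _ (@S_continuous s s0 x) orbit_mean_cvg).
have cE : expR (- mu * s) * `|h^-1 *: K h| @[h --> 0^'+] --> expR (- mu * s) * `|x|.
  by apply: cvgM; [exact: cvg_cst|apply: cvg_norm; exact: orbit_mean_cvg].
apply: (ler_cvg_to cS cE); near=> h.
have h0 : 0 < h by near: h; exact: nbhs_right_gt.
have ht : h < tau - s by near: h; apply: nbhs_right_lt; rewrite subr_gt0.
rewrite SZ// !normrZ mulrCA ler_pM2l ?normr_gt0 ?invr_eq0 ?gt_eqF//.
have hh : 0 < h < tau by rewrite h0/=; lra.
apply: domain_decay s0 (orbit_integral_domain hh) _.
move=> c /andP[c0 cs]; apply: orbit_integral_left_continuous => //; lra.
Unshelve. all: by end_near. Qed.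
End orbit_integral.

(** Integrals of orbits are available only up to time [tau], so the bound is first obtained up to
    [tau / 2]. It has constant 1 in front of the exponential and hence iterates without loss. *)
Lemma semigroup_decay t x : 0 <= t -> `|S t x| <= expR (- mu * t) * `|x|.
Proof.
have short s y : 0 <= s <= tau / 2 -> `|S s y| <= expR (- mu * s) * `|y|.
  move=> /andP[s0 st].
  have /choice[K KE] : forall t : R, exists J, 0 < t <= tau ->
      is_Rint (fun s => S (t - s) y) 0 t J.
    move=> r; have [rt|//] := boolP (0 < r <= tau); last by exists 0.
    by have [J] := integrable y rt; exists J.
  apply: (orbit_decay KE); rewrite s0/=; move: tau_gt0 st; lra.
have [n] : exists n : nat, t <= n%:R * (tau / 2).
  exists (Num.truncn (t / (tau / 2))).+1.
  by rewrite -ler_pdivrMr ?divr_gt0// ltW// truncnS_gt.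
elim: n t x => [|n IH] t x tn t0.
  have -> : t = 0 by apply/le_anti; rewrite t0 andbT; move: tn; rewrite mul0r.
  by rewrite S0 mulr0 expR0 mul1r.
have [tt|tt] := leP t (tau / 2); first by apply: short; rewrite t0.
have -> : t = tau / 2 + (t - tau / 2) by ring.
rewrite SD ?divr_ge0 ?(ltW tau_gt0) ?subr_ge0 ?(ltW tt)//.
apply: le_trans (short _ _ _) _; first by rewrite lexx divr_ge0 ?(ltW tau_gt0).
rewrite mulrDr expRD -mulrA ler_pM2l ?expR_gt0//; apply: IH.
  by rewrite lerBlDr -{2}(mul1r (tau / 2)) -mulrDl natr1.
by rewrite subr_ge0 ltW.
Qed.
End semigroup_contraction.

(** * Mild solutions and contraction of the delay semiflow *)

Lemma hist_extension (R : realType) (tau : R) (V : normedModType R) (h : R -> V) :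
  {within `[- tau, 0], continuous h} ->
  exists phi : hist tau V, forall th, th \in `[- tau, 0] -> phi th = h th.
Proof.
move=> ch; pose k (th : R) := if th \in `[- tau, 0] then h th else 0.
have kP : k \in @hist_pred R tau V.
  rewrite inE; split; last by move=> th /negPf; rewrite /k => ->.
  apply: subspace_eq_continuous ch => th /set_mem thI.
  by rewrite /k /from_subspace (_ : th \in `[- tau, 0]).
by exists (Hist kP) => th thI; rewrite /= /k thI.
Qed.

Section mild_solutions.
Variables (R : realType) (V : normedModType R) (S : R -> V -> V).
Variables (mu sigma tau L : R) (F : V -> V).
Hypotheses (mu_gt0 : 0 < mu) (sigma_ge0 : 0 <= sigma) (tau_gt0 : 0 < tau).
Hypothesis S_C0 : C0_semigroup S.
Hypothesis S_decay : forall t x, 0 <= t -> `|S t x| <= expR (- mu * t) * `|x|.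
Hypothesis F_lipschitz : forall x y, `|F x - F y| <= L * `|x - y|.
Hypothesis L_ge0 : 0 <= L.

Let SB (t : R) (x y : V) : 0 <= t -> S t (x - y) = S t x - S t y.
Proof.
move=> t0; have [H _ _ _] := S_C0; have [lS _] := H t t0.
pose T : {linear V -> V} := HB.pack (S t) (GRing.isLinear.Build _ _ _ _ (S t) lS).
by rewrite -[LHS]/(T (x - y)) linearB.
Qed.

(** The integrand is at most [C exp(- mu (t - s))], which increases in [s]; its left-tagged sums
    therefore stay below the increments of its primitive, the function [G] of the proof. *)
Lemma convolution_diff_le (v1 v2 : R -> V) (t C : R) (J1 J2 : V) : 0 < t ->
  is_Rint (fun s => S (t - s) (v1 s)) 0 t J1 ->
  is_Rint (fun s => S (t - s) (v2 s)) 0 t J2 ->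
  (forall s, 0 <= s <= t -> `|v1 s - v2 s| <= C) ->
  `|J1 - J2| <= C * (1 - expR (- mu * t)) / mu.
Proof.
move=> t0 I1 I2 vC.
have C0 : 0 <= C by apply: le_trans (vC 0 _); rewrite // lexx ltW.
have -> : C * (1 - expR (- mu * t)) / mu =
    C * expR (- mu * (t - t)) / mu - C * expR (- mu * (t - 0)) / mu.
  by rewrite subrr mulr0 expR0 subr0; ring.
apply: (Rint_norm_le (G := fun s => C * expR (- mu * (t - s)) / mu)
  (ltW t0) (Rint_sub I1 I2)) => p q p0 pq qt.
have pt : 0 <= t - p by lra.
have h1 : `|S (t - p) (v1 p) - S (t - p) (v2 p)| <= expR (- mu * (t - p)) * C.
  rewrite -SB//; apply: le_trans (S_decay _ pt) _.
  by rewrite ler_pM2l ?expR_gt0//; apply: vC; lra.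
have h2 : mu * (q - p) * expR (- mu * (t - p)) <=
    expR (- mu * (t - q)) - expR (- mu * (t - p)).
  have -> : - mu * (t - q) = mu * (q - p) + - mu * (t - p) by ring.
  rewrite expRD -{3}(mul1r (expR (- mu * (t - p)))) -mulrBl ler_pM2r ?expR_gt0//.
  by have := expR_ge1Dx (mu * (q - p)); lra.
rewrite -mulrBl -mulrBr ler_pdivlMr//.
apply: (@le_trans _ _ ((q - p) * (expR (- mu * (t - p)) * C) * mu)).
  by rewrite ler_pM2r// ler_wpM2l// subr_ge0.
by have := ler_wpM2l C0 h2; lra.
Qed.

Let q := (sigma + L) / mu.

(** The initial value contributes [exp(- mu t)] and the two delayed terms contribute
    [q (1 - exp(- mu t))]. For [q < 1] the factor is a convex combination of 1 and [q]. *)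
Lemma mild_solution_step (phi1 phi2 : hist tau V) (u1 u2 : R -> V) (t : R) :
  mild_solution S sigma F phi1 u1 -> mild_solution S sigma F phi2 u2 -> 0 < t ->
  (forall s, - tau <= s <= t - tau -> `|u1 s - u2 s| <= `|phi1 - phi2|) ->
  `|u1 t - u2 t| <= (q + (1 - q) * expR (- mu * t)) * `|phi1 - phi2|.
Proof.
move=> [_ _ /(_ t)H1] [_ _ /(_ t)H2] t0 hu; set M := `|phi1 - phi2|.
have [J1 [K1 [IJ1 IK1 ->]]] := H1 t0.
have [J2 [K2 [IJ2 IK2 ->]]] := H2 t0.
have hu' s : 0 <= s <= t -> `|u1 (s - tau) - u2 (s - tau)| <= M.
  by move=> st; apply: hu; lra.
have HJ := convolution_diff_le t0 IJ1 IJ2 hu'.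
have HK : `|K1 - K2| <= L * M * (1 - expR (- mu * t)) / mu.
  apply: (convolution_diff_le t0 IK1 IK2) => s st.
  by apply: le_trans (F_lipschitz _ _) _; rewrite ler_wpM2l// hu'.
have HS : `|S t (phi1 0) - S t (phi2 0)| <= expR (- mu * t) * M.
  rewrite -SB ?(ltW t0)//; apply: le_trans (S_decay _ (ltW t0)) _.
  rewrite ler_pM2l ?expR_gt0//.
  apply: (@hist_norm_ge R tau V (phi1 - phi2) 0).
  by rewrite /= in_itv/= lexx oppr_le0 ltW.
have -> : S t (phi1 0) + sigma *: J1 + K1 - (S t (phi2 0) + sigma *: J2 + K2) =
    (S t (phi1 0) - S t (phi2 0)) + sigma *: (J1 - J2) + (K1 - K2).
  by rewrite scalerBr !opprD addrACA (addrACA (S t (phi1 0))).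
apply: le_trans (ler_normD _ _) _.
apply: le_trans (lerD (ler_normD _ _) (lexx _)) _.
rewrite normrZ (ger0_norm sigma_ge0).
have -> : (q + (1 - q) * expR (- mu * t)) * M =
    expR (- mu * t) * M + sigma * (M * (1 - expR (- mu * t)) / mu) +
    L * M * (1 - expR (- mu * t)) / mu.
  by rewrite /q; field; rewrite gt_eqF.
by apply: lerD => //; apply: lerD => //; rewrite ler_wpM2l.
Qed.

(** Up to time [tau] the distance merely does not grow. For times in [[tau, 2 tau]] the delayed
    arguments lie in [[- tau, tau]], and the factor is at most its value at [t = tau]. *)
Lemma semiflow_contraction (Phi : R -> hist tau V -> hist tau V) :
  solution_semiflow S sigma F Phi -> sigma + L < mu ->
  exists2 kappa, 0 <= kappa < 1 & forall phi1 phi2,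
    `|Phi (2 * tau) phi1 - Phi (2 * tau) phi2| <= kappa * `|phi1 - phi2|.
Proof.
move=> hPhi slm.
have q0 : 0 <= q by rewrite divr_ge0 ?addr_ge0// ltW.
have q1 : q < 1 by rewrite ltr_pdivrMr// mul1r.
have E1 : expR (- mu * tau) < 1.
  by rewrite expR_lt1 mulNr oppr_lt0 mulr_gt0.
exists (q + (1 - q) * expR (- mu * tau)).
  apply/andP; split; last by move: E1 q1; nra.
  by apply: addr_ge0 => //; apply: mulr_ge0; [rewrite subr_ge0 ltW|exact: expR_ge0].
move=> phi1 phi2.
have [u1 M1 P1] := hPhi phi1; have [u2 M2 P2] := hPhi phi2.
have hist0 s : - tau <= s <= 0 -> `|u1 s - u2 s| <= `|phi1 - phi2|.
  move=> sI; have [_ h1 _] := M1; have [_ h2 _] := M2.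
  rewrite h1 ?h2 ?in_itv//.
  by apply: (@hist_norm_ge R tau V (phi1 - phi2) s); rewrite /= in_itv.
have kle s : 0 < s -> (q + (1 - q) * expR (- mu * s)) <= 1.
  move=> s0; have : expR (- mu * s) <= 1.
    by rewrite expR_le1 mulNr oppr_le0 mulr_ge0// ltW.
  by move: q1; nra.
have step s : 0 < s -> (forall r, - tau <= r <= s - tau -> `|u1 r - u2 r| <= `|phi1 - phi2|) ->
    `|u1 s - u2 s| <= `|phi1 - phi2|.
  move=> s0 h; apply: le_trans (mild_solution_step M1 M2 s0 h) _.
  by rewrite -[leRHS]mul1r ler_wpM2r// kle.
have hist1 s : - tau <= s <= tau -> `|u1 s - u2 s| <= `|phi1 - phi2|.
  move=> sI; have [s0|s0] := leP s 0; first by apply: hist0; lra.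
  by apply: step => // r rI; apply: hist0; lra.
apply: hist_norm_le.
  apply: mulr_ge0 => //; apply: addr_ge0 => //.
  by apply: mulr_ge0; [rewrite subr_ge0 ltW|exact: expR_ge0].
move=> th /=; rewrite in_itv/= => thI.
have t20 : 0 <= 2 * tau by rewrite mulr_ge0// ltW.
rewrite -[X in `|X|]/(Phi (2 * tau) phi1 th - Phi (2 * tau) phi2 th).
rewrite P1 ?P2 ?in_itv//.
have s0 : 0 < 2 * tau + th by move: tau_gt0; lra.
apply: le_trans (mild_solution_step M1 M2 s0 _) _.
  by move=> r rI; apply: hist1; lra.
rewrite ler_wpM2r// lerD2l ler_wpM2l ?subr_ge0 ?(ltW q1)// ler_expR.
by rewrite !mulNr lerN2 ler_pM2l//; lra.
Qed.

(** For the constant history [x] and [s <= t <= tau], the delayed value [u (s - tau)] is [x], so the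
    linear delay integral of the mild solution is the orbit integral. *)
Lemma orbit_integrable (Phi : R -> hist tau V -> hist tau V) x t :
  solution_semiflow S sigma F Phi -> 0 < t <= tau ->
  exists J, is_Rint (fun s => S (t - s) x) 0 t J.
Proof.
move=> hPhi /andP[t0 tt].
have [|phi hphi] := @hist_extension R tau V (cst x).
  by move=> y; exact: cvg_cst.
have [u [_ hu mu_] _] := hPhi phi.
have [J [_ [IJ _ _]]] := mu_ t t0; exists J.
apply: Rint_ext IJ => s st.
have sI : s - tau \in `[- tau, 0] by rewrite in_itv/=; lra.
by rewrite hu// hphi.
Qed.
End mild_solutions.

(** * Invariant sets of contractions and their Hausdorff dimension *)

Section point_attractor.
Variables (R : realType) (V : normedModType R).

(** Invariance allows points of [A] to be pulled back inside [A] any number [n] of times, so the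
    diameter is at most [kappa^n] times a bound that compactness provides. *)
Lemma contraction_invariant_subsingleton (T : V -> V) (A : set V) (kappa : R) :
  compact A -> T @` A = A -> 0 <= kappa < 1 ->
  (forall x y, `|T x - T y| <= kappa * `|x - y|) ->
  forall x y, A x -> A y -> x = y.
Proof.
move=> cA TA /andP[k0 k1] Tk.
have [M [Mr hM]] := compact_bounded cA.
have AM z : A z -> `|z| <= M + 1 by apply: hM; rewrite ltrDl.
have diam (n : nat) : forall x y, A x -> A y -> `|x - y| <= kappa ^+ n * (2 * (M + 1)).
  elim: n => [|n IH] x y Ax Ay.
    rewrite mul1r; apply: le_trans (ler_normB _ _) _.
    by have := AM _ Ax; have := AM _ Ay; lra.
  have [x' Ax' <-] : (T @` A) x by rewrite TA.
  have [y' Ay' <-] : (T @` A) y by rewrite TA.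
  apply: le_trans (Tk _ _) _; rewrite exprS -mulrA ler_wpM2l//; exact: IH.
move=> x y Ax Ay; apply/eqP; rewrite -subr_eq0 -normr_le0.
have c0 : kappa ^+ n * (2 * (M + 1)) @[n --> \oo] --> (0 : R).
  rewrite -(mul0r (2 * (M + 1))); apply: cvgM; last exact: cvg_cst.
  by apply: cvg_expr; rewrite ger0_norm.
apply: (ler_cvg_to (cvg_cst `|x - y|) c0).
by apply: nearW => n; exact: diam.
Qed.

Lemma hausdorff_premeasure_subsingleton (A : set V) (s e : R) :
  (forall x y, A x -> A y -> x = y) -> 0 < s -> 0 < e ->
  hausdorff_premeasure A s e = 0%E.
Proof.
move=> A1 s0 e0; apply/le_anti/andP; split; last first.
  apply: le_ereal_inf_tmp => _ [I [c [r [_ _ ->]]]].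
  by apply: esum_ge0 => i _; rewrite lee_fin powR_ge0.
apply/lee_addgt0Pr => eta eta0; rewrite add0e.
have [a Aa] : exists a, A `<=` [set a].
  have [->|/set0P[a Aa]] := eqVneq A set0; first by exists 0.
  by exists a => x Ax; exact: A1.
(* Radii have to be positive, so a single small ball is used, with [r^s <= eta]. *)
pose r := Num.min e (eta `^ s^-1).
have r0 : 0 < r by rewrite lt_min e0 powR_gt0.
apply: (@le_trans _ _ (r `^ s)%:E).
  apply: ereal_inf_lbound; exists [set 0%N], (fun=> a), (fun=> r); split.
  - by move=> _ _; rewrite r0 ge_min lexx.
  - by move=> x /Aa ->; exists 0%N => //; exact: ballxx.
  - by rewrite esum_set1// lee_fin powR_ge0.
have -> : eta = (eta `^ s^-1) `^ s by rewrite -powRrM mulVf ?gt_eqF// powRr1 ?ltW.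
rewrite lee_fin ge0_ler_powR ?nnegrE ?powR_ge0 ?(ltW r0) ?(ltW s0)//.
by rewrite /r ge_min lexx orbT.
Qed.

(** The exponent 0 is only approached: there every ball counts for 1 and a point has positive
    measure. *)
Lemma hausdorff_dim_subsingleton (A : set V) :
  (forall x y, A x -> A y -> x = y) -> (hausdorff_dim A <= 0)%E.
Proof.
move=> A1; apply/lee_addgt0Pr => s s0; rewrite add0e.
apply: ereal_inf_lbound; exists s => //; split; first exact: ltW.
apply: cvg_lim => //.
have H : (fun=> 0%E : \bar R) x @[x --> (0 : R)^'+] --> (0%E : \bar R) by exact: cvg_cst.
apply: cvg_trans H; apply: near_eq_cvg.
apply: filterS (nbhs_right_gt (0 : R)) => e e0.
by rewrite hausdorff_premeasure_subsingleton.
Qed.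
End point_attractor.

(** * Nontriviality of L2 of the whole space, for the sign of the Lipschitz constant *)

Section L2_nontrivial.
Context d (T : measurableType d) (R : realType).

Lemma indic_Lfun2 (m : {measure set T -> \bar R}) (F : set T) :
  measurable F -> (m F < +oo)%E -> (\1_F : T -> R) \in Lfun m 2%:E.
Proof.
move=> mF Foo; rewrite inE; apply/andP; split; first by rewrite inE/=.
rewrite inE/= /finite_norm; apply: (@lty_poweRy _ _ 2) => //.
rewrite powR_Lnorm//.
have E x : (`|(EFin \o (\1_F : T -> R)) x| `^ 2 = (\1_F x)%:E)%E.
  by rewrite /= indicE; case: (x \in F); rewrite /= ?normr1 ?powR1// normr0 powR0.
by under eq_integral do rewrite E; rewrite integral_indic// setIT.
Qed.

(* By sigma-finiteness, L2(m) = 0 forces m = 0. *)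
Lemma L2_restr_trivial (m : {sigma_finite_measure set T -> \bar R}) (D : set T)
    (mD : measurable D) : (forall y : LspaceType2 m, y = 0) ->
  forall x : LspaceType2 (mrestr m mD), x = 0.
Proof.
move=> y0 x.
have [F [TF mF]] := sigma_finiteT m.
have F0 k : m.-negligible (F k).
  have [mFk Fk] := mF k.
  pose h := Lfun_Sub (lee1n 2) (indic_Lfun2 mFk Fk).
  have E : Lcls h = Lcls 0 by rewrite (y0 (Lcls h)).
  have h0 : (h : T -> R) = (0 : LfunType m (lee1n 2)) %[ae m].
    apply: ae_eq_trans (ae_eq_sym (LclsE h)) _; rewrite E; exact: LclsE.
  apply: negligibleS h0 => t Ft /= /(_ I) ht.
  have : \1_(F k) t = 0 :> R by exact: ht.
  by rewrite indicE mem_set// => /eqP; rewrite oner_eq0.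
have [B [mB B0 TB]] : m.-negligible [set: T].
  by rewrite TF; apply: negligible_bigcup.
apply: Lspace_inj; exists setT; split => //.
rewrite /mrestr; apply/eqP; rewrite -measure_le0 -B0.
by apply: le_measure; rewrite ?inE//; [exact: measurableI|exact: subset_trans (@subsetT _ _) TB].
Qed.
End L2_nontrivial.

(** * Finite rank of the spectral projection *)

Section finite_rank.
Variables (R : realType) (H : normedModType R).
Implicit Types (W : seq H) (v w : H).

Definition inspan W v :=
  exists c : nat -> R, v = \sum_(i < size W) c i *: W`_i.

Lemma inspanD W v w : inspan W v -> inspan W w -> inspan W (v + w).
Proof.
move=> [c ->] [b ->]; exists (fun i => c i + b i).
by rewrite -big_split; apply: eq_bigr => i _; rewrite scalerDl.
Qed.

Lemma inspanZ W a v : inspan W v -> inspan W (a *: v).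
Proof.
move=> [c ->]; exists (fun i => a * c i).
by rewrite scaler_sumr; apply: eq_bigr => i _; rewrite scalerA.
Qed.

Lemma inspan0 W : inspan W 0.
Proof. by exists (fun=> 0); rewrite big1// => i _; rewrite scale0r. Qed.

Lemma inspan_sum W (I : Type) (s : seq I) (Q : pred I) (h : I -> H) :
  (forall i, Q i -> inspan W (h i)) -> inspan W (\sum_(i <- s | Q i) h i).
Proof. by move=> hW; elim/big_rec: _ => [|i v Qi]; [exact: inspan0|exact/inspanD/hW]. Qed.

Lemma inspan_mem W w : w \in W -> inspan W w.
Proof.
move=> wW; exists (fun i => (i == index w W)%:R).
have iW : (index w W < size W)%N by rewrite index_mem.
rewrite (bigD1 (Ordinal iW))//= eqxx scale1r nth_index// big1 ?addr0// => i.
by rewrite -val_eqE /= => /negPf ->; rewrite scale0r.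
Qed.

Lemma inspanS W W' v : {subset W <= W'} -> inspan W v -> inspan W' v.
Proof.
move=> WW' [c ->]; apply: inspan_sum => i _; apply: inspanZ; apply: inspan_mem.
by apply: WW'; exact: mem_nth.
Qed.

(** The first component of [(a + i b) e] is [a e.1 - b e.2], so both components of the basis vectors
    serve as real generators. *)
Lemma cdim_inspan (E : set (H * H)) n : has_cdim E n ->
  exists W, forall x, E x -> inspan W x.1.
Proof.
move=> [e [_ ->]].
exists ([seq (e i).1 | i <- enum 'I_n] ++ [seq (e i).2 | i <- enum 'I_n]).
move=> _ [c _ <-]; rewrite raddf_sum/=; apply: inspan_sum => i _ /=.
rewrite -scaleNr; apply: inspanD; apply: inspanZ; apply: inspan_mem;
  rewrite mem_cat; apply/orP; [left|right]; apply/mapP; exists i => //;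
  exact: mem_enum.
Qed.

Lemma cdims_inspan (G : R[i] -> set (H * H)) (s : seq R[i]) :
  (forall l, l \in s -> exists n, has_cdim (G l) n) ->
  exists W, forall l x, l \in s -> G l x -> inspan W x.1.
Proof.
elim: s => [|l s IH] hs; first by exists [::].
have [n /cdim_inspan[W1 h1]] := hs l (mem_head _ _).
have [|W2 h2] := IH; first by move=> k ks; apply: hs; rewrite inE ks orbT.
exists (W1 ++ W2) => k x; rewrite inE => /predU1P[->|ks] Gx.
  by apply: inspanS (h1 _ Gx) => y; rewrite mem_cat => ->.
by apply: inspanS (h2 _ _ ks Gx) => y; rewrite mem_cat orbC => ->.
Qed.

(** The coordinates of the images form a matrix with one more row than columns, which has a nonzero
    left kernel vector. *)
Lemma finite_rank_dependent (P : H -> H) W (v : 'I_(size W).+1 -> H) :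
  linear P -> (forall x, inspan W (P x)) ->
  exists c : 'I_(size W).+1 -> R, (exists j, c j != 0) /\
    P (\sum_j c j *: v j) = 0.
Proof.
move=> lP /(_ _)/cid PW.
pose C := \matrix_(j < (size W).+1, i < size W) sval (PW (v j)) i.
have : kermx C != 0.
  rewrite kermx_eq0 /row_free neq_ltn; apply/orP; left.
  by rewrite ltnS rank_leq_col.
move=> /rowV0Pn[u /sub_kermxP uC u0].
exists (fun j => u ord0 j); split.
  by apply/rV0Pn.
pose L : {linear H -> H} := HB.pack P (GRing.isLinear.Build _ _ _ _ P lP).
rewrite -[LHS]/(L _) linear_sum.
transitivity (\sum_j \sum_(i < size W) (u ord0 j * C j i) *: W`_i).
  apply: eq_bigr => j _; rewrite linearZ /= -[P _]/(P (v j)).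
  rewrite {1}(svalP (PW (v j))) scaler_sumr; apply: eq_bigr => i _.
  by rewrite scalerA mxE.
rewrite exchange_big big1//= => i _; rewrite -scaler_suml.
by move/matrixP/(_ ord0 i): uC; rewrite !mxE => ->; rewrite scale0r.
Qed.

(** The range condition makes [(P x, P x)] a sum of generalized eigenvectors for eigenvalues in the
    finite list [s]. *)
Lemma spectral_projection_rank (A : H -> H -> Prop) (L : set R[i]) (P : H -> H) :
  spectral_projection A L P ->
  (forall l, L l -> exists n, has_cdim (gen_eigenspace A l) n) ->
  exists W, forall x, inspan W (P x).
Proof.
move=> [lP _ [s [_ [_ sL _ _]]] PE] hL.
have [|W hW] := @cdims_inspan (gen_eigenspace A) s.
  by move=> l /sL; exact: hL.
exists W => x.
have : gen_eigenspaces A L (P x, P x) by rewrite -PE; exists (x, x).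
move=> [r [y [hy /(congr1 fst)/= ->]]].
rewrite raddf_sum big_seq; apply: inspan_sum => l /hy[/sL ls Gl].
exact: hW ls Gl.
Qed.
End finite_rank.

(** * Lower bound for the projected delay semigroup before time [tau] *)

Section delay_shift.
Variables (R : realType) (V : normedModType R) (tau : R).

Lemma bump_hist (a p del : R) (x0 : V) : - tau <= a -> a <= p - del -> p + del <= 0 ->
  0 < del -> exists phi : hist tau V,
   [/\ forall th, th <= a -> phi th = 0,
       forall th, del <= `|th - p| -> phi th = 0 & phi p = (2 * del) *: x0].
Proof.
move=> ta apd pd d0.
(* Twice the positive part of [del - |th - p|]: a tent of height [2 del]. *)
pose k (th : R) := `|del - `|th - p| | + (del - `|th - p|).
have [|phi hphi] := @hist_extension R tau V (fun th => k th *: x0).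
  apply: continuous_subspaceT => th; apply: cvgZr_tmp.
  have c : del - `|y - p| @[y --> th] --> del - `|th - p|.
    apply: cvgB; first exact: cvg_cst.
    by apply: cvg_norm; apply: cvgB; [exact: cvg_id|exact: cvg_cst].
  by apply: cvgD => //; exact: cvg_norm.
have far th : del <= `|th - p| -> phi th = 0.
  move=> hth; have [thI|thI] := boolP (th \in `[- tau, 0]); last exact: hist_out.
  by rewrite hphi// /k ler0_norm ?subr_le0// addNr scale0r.
exists phi; split => //.
  by move=> th tha; apply: far; rewrite distrC ger0_norm; lra.
rewrite hphi ?in_itv/=; last by lra.
by rewrite /k subrr normr0 subr0 gtr0_norm// mulr_natl.
Qed.

(* Histories supported in [t_0 - tau, 0] are translated by U(t_0) without loss of
   norm, and they form an infinite-dimensional space, so some are killed by P. *)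
Lemma projected_delay_ge1 (S : R -> V -> V) (sigma : R) (F : V -> V)
    (U : R -> hist tau V -> hist tau V) (P : hist tau V -> hist tau V)
    (W : seq (hist tau V)) (x0 : V) (t0 C : R) :
  solution_semiflow S sigma F U -> linear P -> (forall x, inspan W (P x)) ->
  x0 != 0 -> 0 < t0 < tau ->
  (forall x, `|U t0 (x - P x)| <= C * `|x|) -> 1 <= C.
Proof.
move=> hU lP PW x00 /andP[t00 t0t] hC.
pose n := (size W).+1.
have n0 : 0 < n%:R :> R by rewrite ltr0n.
(* The [n] tents of half-width [del] centred at the [p j] tile [[t0 - tau, 0]]. There is one more of
   them than generators of the range of [P]. *)
pose del := (tau - t0) / (2 * n%:R).
have d0 : 0 < del by rewrite divr_gt0 ?subr_gt0// mulr_gt0.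
have dn : del * (2 * n%:R) = tau - t0 by rewrite divfK// gt_eqF// mulr_gt0.
pose p (j : nat) := t0 - tau + del * (2 * j%:R + 1).
have pI (j : nat) : (j < n)%N -> t0 - tau <= p j - del /\ p j + del <= 0.
  rewrite -(ler_nat R) -natr1 => jn; have j0 : 0 <= j%:R :> R by [].
  by rewrite /p; split; nra.
have /choice[v hv] : forall j : 'I_n, exists phi : hist tau V,
   [/\ forall th, th <= t0 - tau -> phi th = 0,
       forall th, del <= `|th - p j| -> phi th = 0 & phi (p j) = (2 * del) *: x0].
  by move=> j; have [h1 h2] := pI j (ltn_ord j); apply: bump_hist => //; lra.
have [c [[k ck] Pc]] := finite_rank_dependent v lP PW.
pose phi := \sum_j c j *: v j.
have phiE th : phi th = \sum_j c j *: v j th.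
  rewrite /phi; elim/big_rec2: _ => // j y z _ <-; exact: histD.
(* The supports do not overlap, so at [p k] only the tent with nonzero coefficient [c k]
   survives. *)
have phik : phi (p k) != 0.
  rewrite phiE (bigD1 k)//= big1 ?addr0 => [|j jk].
    have d2 : 2 * del != 0 by rewrite gt_eqF// mulr_gt0.
    by have [_ _ ->] := hv k; rewrite scaler_eq0 negb_or ck/= scaler_eq0 negb_or d2.
  have [_ h _] := hv j; rewrite h ?scaler0//.
  have -> : p k - p j = del * (2 * (k%:R - j%:R)) by rewrite /p; ring.
  rewrite normrM gtr0_norm// ler_pMr// normrM ger0_norm//.
  suff : 1 <= `|k%:R - j%:R| :> R by lra.
  move: jk; rewrite -val_eqE /= neq_ltn => /orP[|] h'.
    by rewrite ger0_norm ?subr_ge0 ?ler_nat ?(ltnW h')// lerBrDr nat1r ler_nat.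
  by rewrite ler0_norm ?subr_le0 ?ler_nat ?(ltnW h')// opprB lerBrDr nat1r ler_nat.
have phi0 : 0 < `|phi|.
  have [h1 h2] := pI k (ltn_ord k).
  apply: (@lt_le_trans _ _ `|phi (p k)|); first by rewrite normr_gt0.
  by apply: (@hist_norm_ge R tau V phi); rewrite /= in_itv/=; lra.
have := hC phi; rewrite Pc subr0 => hCphi.
rewrite -(ler_pM2r phi0) mul1r; apply: le_trans hCphi.
have [u [_ hu _] Uu] := hU phi.
apply: hist_norm_le => // th /=; rewrite in_itv/= => /andP[th1 th2].
have [tht|tht] := leP th (t0 - tau).
  rewrite phiE big1 ?normr0 ?normr_ge0// => j _.
  by have [h _ _] := hv j; rewrite h// scaler0.
(* For [t0 - tau < th <= 0] the solution at [th] is still its initial history, and [th - t0] is an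
   admissible delay. *)
have -> : phi th = U t0 phi (th - t0).
  by rewrite Uu ?(ltW t00) ?in_itv/=; [rewrite subrKC hu// in_itv/= th1|lra|lra].
by apply: (@hist_norm_ge R tau V (U t0 phi)); rewrite /= in_itv/=; lra.
Qed.
End delay_shift.

(** * Real parts and multiplicities of the eigenvalues *)

Section multiplicities.
Variables (R : realType) (H : normedModType R) (A : H -> H -> Prop).
Variables (rho : nat -> R) (n : nat -> nat).
Hypotheses (hrho : real_parts A rho) (hn : real_part_multiplicity A rho n).

Lemma real_parts_eigenvalue j : (0 < j)%N ->
  exists2 l, eigenvalue_of A l & complex.Re l = rho j.
Proof.
move=> j0; have [_ E] := hrho.
have : [set rho j | j in [set j | (0 < j)%N]] (rho j) by exists j.
by rewrite E => -[l]; exists l.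
Qed.

Lemma real_parts_le j : (0 < j)%N -> rho j <= rho 1%N.
Proof.
case: j => // j _; elim: j => // j IH; have [h _] := hrho.
by apply: le_trans IH; exact/ltW/h.
Qed.

Lemma real_part_cdim j l : (0 < j)%N -> eigenvalue_of A l -> complex.Re l = rho j ->
  exists2 a, has_cdim (gen_eigenspace A l) a & (a <= n j)%N.
Proof.
move=> j0 Al lj; have [s [a [us sP ha ->]]] := hn j0.
have ls : l \in s by apply/sP.
by exists (a l); [exact: ha|rewrite (bigD1_seq l)//= leq_addr].
Qed.

Lemma gen_eigenspace_dim_gt0 l a : eigenvalue_of A l ->
  has_cdim (gen_eigenspace A l) a -> (0 < a)%N.
Proof.
move=> [x x0 Ax] [e [_ E]]; rewrite lt0n; apply: contra x0 => /eqP a0.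
have : gen_eigenspace A l x.
  by exists 1%N => /=; exists (Defs.cscale l x) => //=; rewrite subrr.
by rewrite E => -[c _ <-]; rewrite big1// => i; have := ltn_ord i; rewrite {2}a0.
Qed.

Lemma multiplicity_gt0 j : (0 < j)%N -> (0 < n j)%N.
Proof.
move=> j0; have [l Al lj] := real_parts_eigenvalue j0.
have [a ha] := real_part_cdim j0 Al lj; apply: leq_trans.
exact: gen_eigenspace_dim_gt0 Al ha.
Qed.

Lemma eigenvalue_nontrivial : exists x : H, x != 0.
Proof.
have [l [[x y] xy _] _] := real_parts_eigenvalue (isT : (0 < 1)%N).
have [x0|x0] := eqVneq x 0; last by exists x.
have [y0|y0] := eqVneq y 0; last by exists y.
by move: xy; rewrite x0 y0 eqxx.
Qed.

Lemma leading_eigenvalues_cdim m l : leading_eigenvalues A rho m l ->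
  exists a, has_cdim (gen_eigenspace A l) a.
Proof.
move=> [Al [j /andP[j0 _] lj]].
by have [a ha _] := real_part_cdim j0 Al lj; exists a.
Qed.
End multiplicities.

Theorem theorem6p1 (R : realType) (N : nat) (hN : (1 <= N)%N)
  (mu sigma tau : R) (hmu : 0 < mu) (hsigma : 0 < sigma) (htau : 0 < tau)
  (g : L2_space R N) (f : L2_space R N -> L2_space R N)
  (L_f : R) (f0 : f 0 = 0)
  (f_lipschitz : forall phi1 phi2 : hist tau (L2_space R N),
     `|f (phi1 (- tau)) - f (phi2 (- tau))| <= L_f * `|phi1 - phi2|)
  (hdiss : sigma * (L_f + 1) * expR (mu * tau) - mu < 0)
  (S : R -> L2_space R N -> L2_space R N)
  (hS : generated_by S (laplacian_minus (lebesgue_rV R N) [set: 'rV[R]_N] mu))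
  (Phi : R -> hist tau (L2_space R N) -> hist tau (L2_space R N))
  (hPhi : solution_semiflow S sigma (fun v => f v + g) Phi)
  (A : set (hist tau (L2_space R N)))
  (hA : global_attractor Phi A)
  (eps : R) (heps : 0 < eps)
  (D : set (hist tau (L2_space R N))) (hD : bounded_set D)
  (T_eps K : R) (hT_eps : 0 < T_eps) (hK : 0 < K)
  (tails : forall phi, D phi -> forall t, T_eps <= t -> forall K', K <= K' ->
     (ereal_sup [set \int[lebesgue_rV R N]_(x in [set x | (K' <= enorm x)%R])
                       ((Phi t phi zeta x) ^+ 2)%:E
                | zeta in `[(- tau)%R, 0%R]] <= eps%:E)%E)
  (S_K : R -> L2_ball N K -> L2_ball N K)
  (hS_K : generated_by S_K (laplacian_minus (lebesgue_eball N K) (eball N K) mu))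
  (U : R -> hist tau (L2_ball N K) -> hist tau (L2_ball N K))
  (hU : solution_semiflow S_K sigma (fun=> 0) U)
  (rho : nat -> R) (hrho : real_parts (generator U) rho)
  (n : nat -> nat) (hn : real_part_multiplicity (generator U) rho n)
  (m : nat) (hm : (1 <= m)%N) (rho_m_lt0 : rho m < 0)
  (P : hist tau (L2_ball N K) -> hist tau (L2_ball N K))
  (hP : spectral_projection (generator U)
          (leading_eigenvalues (generator U) rho m) P)
  (K_m : R) (hK_m : 0 < K_m)
  (hUQ : forall t, 0 <= t -> forall x,
     `|U t (x - P x)| <= K_m * expR (rho m * t) * `|x|) :
  let k_m := (\sum_(1 <= j < m.+1) n j)%N in
  let c_2 := expR ((mu - sigma - 1) * tau) in
  forall t_0 alpha : R, 0 < t_0 -> 0 < alpha < 2 ->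
  let eta :=
    2 * K_m * expR (rho m * t_0)
    + (alpha + 2 * K_m * L_f / (rho 1%N + L_f - rho m))
      * expR ((L_f + rho 1%N) * t_0)
    + 2 * Num.sqrt c_2
      * expR ((c_2 * (sigma + L_f ^+ 2) - (mu - sigma - 1)) * t_0 / 2) in
  eta < 1 ->
  (hausdorff_dim A <
   ((- ln k_m%:R - k_m%:R * ln (2 + 4 / alpha)) / ln eta)%:E)%E.
Proof.
move=> k_m c_2 t_0 alpha t00 /andP[alpha0 alpha2] eta eta1.
have [S_C0 S_gen] := hS.
have diss x y : generator S x y -> dot x y <= - mu * `|x| ^+ 2.
  by move=> /S_gen; exact: laplacian_minus_dissipative.
have S_decay : forall t x, 0 <= t -> `|S t x| <= expR (- mu * t) * `|x|.
  move=> t x; apply: (semigroup_decay htau S_C0 diss) => y s.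
  exact: orbit_integrable hPhi.
have const_hist (x : L2_space R N) : exists phi : hist tau (L2_space R N),
    forall th, th \in `[- tau, 0] -> phi th = x.
  by apply: hist_extension => y; exact: cvg_cst.
have tauI : - tau \in `[- tau, 0] by rewrite in_itv/= lexx oppr_le0 ltW.
(* The value [rho 1] is attained by an eigenvalue; some value of a nonzero component of its
   eigenvector is nonzero. *)
have [xb xb0] : exists xb : L2_ball N K, xb != 0.
  have [phi phi0] := eigenvalue_nontrivial hrho.
  apply: contrapT => /forallNP h; move/eqP: phi0; apply.
  apply: val_inj; apply/funext => th.
  by apply/eqP; apply: contrapT => /negP; exact: h.
(* The Lipschitz inequality between two distinct constant histories forces the sign; the whole space
   has a nonzero element because the ball has one. *)
have L_f_ge0 : 0 <= L_f.
  have [y y0] : exists y : L2_space R N, y != 0.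
    apply: contrapT => /forallNP h; move/eqP: xb0; apply.
    apply: L2_restr_trivial => y; apply/eqP; apply: contrapT => /negP; exact: h.
  have [phi1 h1] := const_hist y; have [phi2 h2] := const_hist 0.
  have : 0 <= L_f * `|phi1 - phi2| := le_trans (normr_ge0 _) (f_lipschitz _ _).
  rewrite pmulr_lge0//; apply: (@lt_le_trans _ _ `|phi1 (- tau) - phi2 (- tau)|).
    by rewrite h1// h2// subr0 normr_gt0.
  exact: (@hist_norm_ge _ _ _ (phi1 - phi2) (- tau)).
have F_lipschitz x y : `|f x + g - (f y + g)| <= L_f * `|x - y|.
  have [phi1 h1] := const_hist x; have [phi2 h2] := const_hist y.
  rewrite opprD addrACA subrr addr0.
  have := f_lipschitz phi1 phi2; rewrite h1// h2// => /le_trans; apply.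
  rewrite ler_wpM2l//; apply: hist_norm_le => // th thI.
  by rewrite -[X in `|X|]/(phi1 th - phi2 th) h1// h2.
have [W PW] := spectral_projection_rank hP (@leading_eigenvalues_cdim _ _ _ _ _ hn m).
have rho_le : rho m <= rho 1%N := real_parts_le hrho hm.
pose e1 := 2 * K_m * expR (rho m * t_0).
pose e2 := (alpha + 2 * K_m * L_f / (rho 1%N + L_f - rho m)) *
  expR ((L_f + rho 1%N) * t_0).
pose e3 := 2 * Num.sqrt c_2 *
  expR ((c_2 * (sigma + L_f ^+ 2) - (mu - sigma - 1)) * t_0 / 2).
have e1_gt0 : 0 < e1 by rewrite !mulr_gt0 ?expR_gt0.
(* The denominator is only known to be nonnegative. It vanishes when [rho 1 = rho m] and [L_f = 0],
   and the quotient is then 0 by convention. *)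
have e2_ge0 : 0 <= e2.
  apply: mulr_ge0; last exact: expR_ge0.
  apply: addr_ge0; first exact: ltW.
  apply: divr_ge0; last by lra.
  by rewrite mulr_ge0// mulr_ge0// ltW.
have e3_gt0 : 0 < e3 by rewrite !mulr_gt0 ?sqrtr_gt0 ?expR_gt0.
have e_lt1 : e1 + e2 + e3 < 1 by [].
clear eta1.
have tau_le : tau <= t_0.
  rewrite leNgt; apply/negP => t0tau.
  have [lP _ _ _] := hP.
  have := projected_delay_ge1 (t0 := t_0) (C := K_m * expR (rho m * t_0))
    hU lP PW xb0.
  rewrite t00 t0tau => /(_ isT (hUQ _ (ltW t00))) C1.
  have : 2 * 1 <= e1 by rewrite /e1 -mulrA ler_pM2l.
  lra.
have slm : sigma + L_f < mu.
  pose a := mu - sigma - 1; pose B := sigma + L_f ^+ 2.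
  have B0 : 0 < B by rewrite ltr_pwDl// sqr_ge0.
  have sqrtE : Num.sqrt c_2 = expR (a * tau / 2).
    have -> : c_2 = expR (a * tau / 2) ^+ 2.
      by rewrite -expRM_natl; congr expR; rewrite /a; field.
    by rewrite sqrtr_sqr gtr0_norm ?expR_gt0.
  (* The sign of this exponent gives [c_2 B t_0 < a (t_0 - tau)]. The left side is positive and
     [tau <= t_0], so [a > 0]; hence [c_2 > 1] and [B < c_2 B < a]. The claim then follows from
     [L_f <= 1 + L_f^2]. *)
  have : expR (a * tau / 2 + (c_2 * B - a) * t_0 / 2) < 1.
    rewrite expRD -sqrtE.
    have : e3 < 1 by lra.
    by move: e3_gt0; rewrite /e3 -/B -/a -!mulrA; set z := Num.sqrt _ * _; lra.
  rewrite expR_lt1 => h.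
  have c0 : 0 < c_2 by exact: expR_gt0.
  have cBt : 0 < c_2 * B * t_0 by rewrite !mulr_gt0.
  have at0 : 0 < a * (t_0 - tau) by lra.
  have a0 : 0 < a.
    rewrite ltNge; apply/negP => a_le0; have tt : 0 <= t_0 - tau by lra.
    have := mulr_le0_ge0 a_le0 tt; lra.
  have atau : 0 < a * tau by rewrite mulr_gt0.
  have c1 : 1 < c_2 by rewrite expR_gt1 mulr_gt0.
  have : c_2 * B < a by rewrite -(ltr_pM2r t00); lra.
  have : B < c_2 * B by rewrite ltr_pMl.
  rewrite /B /a; nra.
have [kappa kappa01 contr] := semiflow_contraction hmu (ltW hsigma) htau S_C0
  S_decay F_lipschitz L_f_ge0 hPhi slm.
have [cA inv _] := hA.
have tau2 : 0 <= 2 * tau by rewrite mulr_ge0// ltW.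
have A1 := contraction_invariant_subsingleton cA (inv _ tau2) kappa01 contr.
apply: le_lt_trans (hausdorff_dim_subsingleton A1) _; rewrite lte_fin.
have k1 : (1 <= k_m)%N.
  rewrite /k_m big_ltn// ltn_addr//; exact: multiplicity_gt0 hrho hn _ _.
have lnk : 0 <= ln (k_m%:R : R) by rewrite ln_ge0// ler1n.
have lna : 0 < ln (2 + 4 / alpha).
  by rewrite ln_gt0//; have : 0 < 4 / alpha; [rewrite divr_gt0|lra].
have klna : 0 < k_m%:R * ln (2 + 4 / alpha) by rewrite mulr_gt0// ltr0n.
have lneta : ln eta < 0 by apply: ln_lt0; rewrite /eta -/e1 -/e2 -/e3; lra.
by rewrite -mulrNN mulr_gt0 ?oppr_gt0 ?invr_lt0//; lra.
Qed.
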